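(* Let $T>0$, $P>0$, $\mathcal{E}>0$ and $\epsilon>0$ be constants. Let $u\in C([0,T];H^1(\mathbb{T}^2))$ (with values in $\mathbb{R}^2$) and $\sigma\in C([0,T];H^1_w(\mathbb{T}^2))\cap C([0,T];L^2(\mathbb{T}^2))$ (with values in the symmetric $2\times 2$ matrices), with $\sigma_0 := \sigma(\cdot,0)\in L^\infty(\mathbb{T}^2)\cap H^1(\mathbb{T}^2)$, be two functions which satisfy $$\frac{1}{\mathcal{E}}\partial_t\sigma+\frac{4\mathcal{D}_\epsilon}{P}\Big(\sigma-\frac12\operatorname{Tr}\sigma\,\mathbb{I}_2\Big)+\frac{\mathcal{D}_\epsilon}{2P}\operatorname{Tr}\sigma\,\mathbb{I}_2+\frac{\mathcal{D}_\epsilon}{2}\mathbb{I}_2=D(u)$$ on $\mathbb{T}^2\times(0,T)$. Then $\sigma\in L^\infty((0,T);L^\infty(\mathbb{T}^2))$ and $$\|\sigma(\cdot,t)\|_{L^\infty}\le\|\sigma_0\|_{L^\infty}+2P.$$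
   Context: $\mathbb{T}^2=(\mathbb{R}/\mathbb{Z})^2$ is the flat two-dimensional torus. $D(u)=\frac12[\nabla u+(\nabla u)^\top]$ and $\mathcal{D}_\epsilon=\sqrt{|D(u)|^2+\epsilon^2}$, where $|A|=\big(\sum_{i,j=1}^2|A_{ij}|^2\big)^{1/2}$ is the Euclidean norm of a tensor; the $L^\infty$ norm of a matrix field is taken with respect to this norm. $\mathbb{I}_2$ is the $2\times2$ identity matrix and $\operatorname{Tr}$ the trace. $H^1_w(\mathbb{T}^2)$ denotes $H^1(\mathbb{T}^2)$ with its weak topology. *)

(* Defs.v *)
From HB Require Import structures.
From mathcomp Require Import all_boot all_order all_algebra.
From mathcomp Require Import all_classical all_reals all_analysis.

Set Implicit Arguments.
Unset Strict Implicit.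
Unset Printing Implicit Defensive.

Import Order.TTheory GRing.Theory Num.Theory.
Import numFieldNormedType.Exports.

Local Open Scope classical_set_scope.
Local Open Scope ring_scope.

(* A function on the torus T^2 = (R/Z)^2 is a function on R * R which is
   1-periodic in each variable, and T^2 carries the Lebesgue measure of the
   fundamental domain [0, 1[ x [0, 1[.  Elements of Lebesgue and Sobolev spaces
   are handled through measurable periodic representatives: the spaces and norms
   below do not depend on the choice of a representative in its class for
   equality almost everywhere. *)

Section torus.
Variable R : realType.

Definition circle : set (measurableTypeR R) := `[0%R, 1%R[%classic.

Lemma measurable_circle : measurable circle.
Proof. exact: measurable_itv. Qed.

Lemma lebesgue_circle_lty : (lebesgue_measure circle < +oo)%E.
Proof. by rewrite /circle lebesgue_measure_itv /= lte_fin ltr01 ltry. Qed.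

Definition circle_measure : set (measurableTypeR R) -> \bar R :=
  mfrestr measurable_circle lebesgue_circle_lty.

HB.instance Definition _ := FiniteMeasure.on circle_measure.

Definition torus_measure :
    set (measurableTypeR R * measurableTypeR R)%type -> \bar R :=
  (circle_measure \x circle_measure)%E.

HB.instance Definition _ := Measure.on torus_measure.

Lemma torus_measureT : torus_measure setT = (circle_measure setT ^+ 2)%E.
Proof.
rewrite -[RHS](product_measure1E circle_measure circle_measure) //.
by rewrite setXTT.
Qed.

Lemma torus_measure_fin_num : fin_num_fun torus_measure.
Proof.
have : (torus_measure setT < +oo)%E.
  by rewrite torus_measureT ltey_eq fin_numX// fin_num_measure.
exact: lty_fin_num_fun.
Qed.

HB.instance Definition _ :=
  Measure_isFinite.Build _ _ _ torus_measure torus_measure_fin_num.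

Definition torus_dir (i : 'I_2) : R * R := if i == 0 then (1, 0) else (0, 1).

Definition torus_periodic (f : R * R -> R) : Prop :=
  forall i, periodic f (torus_dir i).

Definition torus_L (p : \bar R) (f : R * R -> R) : Prop :=
  torus_periodic f /\ f \in Lfun torus_measure p.

Definition iter_deriv (V : normedModType R) (s : seq V) (f : V -> R) : V -> R :=
  foldr (fun v (g : V -> R) => 'D_v g) f s.

(* When B is a basis of a finite-dimensional V, this is the usual C^oo class:
   the partial derivatives of all orders exist and are continuous. *)
Definition smooth (V : normedModType R) (B : seq V) (f : V -> R) : Prop :=
  forall s : seq V, {subset s <= B} ->
    continuous (iter_deriv s f) /\
    (forall v x, v \in B -> derivable (iter_deriv s f) x v).

Definition torus_test (phi : R * R -> R) : Prop :=
  smooth [seq torus_dir i | i : 'I_2] phi /\ torus_periodic phi.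

Definition is_weak_deriv (i : 'I_2) (f g : R * R -> R) : Prop :=
  torus_L 2%:E g /\
  forall phi, torus_test phi ->
    \int[torus_measure]_x (f x * 'D_(torus_dir i) phi x) =
    - \int[torus_measure]_x (g x * phi x).

Definition H1 (f : R * R -> R) : Prop :=
  torus_L 2%:E f /\ forall i, exists g, is_weak_deriv i f g.

(* A weak derivative is unique up to almost everywhere equality; for f in H1
   this is a representative of it. *)
Definition weak_deriv (i : 'I_2) (f : R * R -> R) : R * R -> R :=
  xget (cst 0) [set g | is_weak_deriv i f g].

Definition L2norm (f : R * R -> R) : \bar R :=
  'N[torus_measure]_(2%:E)[EFin \o f]%E.

Definition H1norm (f : R * R -> R) : \bar R :=
  ((L2norm f ^+ 2 + \sum_(i < 2) L2norm (weak_deriv i f) ^+ 2) `^ 2^-1)%E.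

(* The continuous linear functionals on H1.  Boundedness forces such a
   functional to depend only on the almost everywhere class of its argument;
   its values outside of H1 are irrelevant. *)
Definition H1_dual (l : (R * R -> R) -> R) : Prop :=
  (forall (a : R) f g, H1 f -> H1 g ->
     l (fun x => a * f x + g x) = a * l f + l g) /\
  (exists C : R, forall f, H1 f -> (`|l f|%:E <= C%:E * H1norm f)%E).

(* For T > 0 the three definitions below are the spaces C([0,T]; X) with
   X = L^2(T^2), H^1(T^2) and H^1_w(T^2), for scalar functions; for vector and
   matrix fields they are used componentwise. *)

Definition C_L2 (T : R) (v : R -> R * R -> R) : Prop :=
  (forall t : R, 0 <= t <= T -> torus_L 2%:E (v t)) /\
  (forall s : R, 0 <= s <= T ->
     L2norm (v t \- v s) @[t --> within `[0, T] (nbhs s)] --> 0%E).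

Definition C_H1 (T : R) (v : R -> R * R -> R) : Prop :=
  (forall t : R, 0 <= t <= T -> H1 (v t)) /\
  (forall s : R, 0 <= s <= T ->
     H1norm (v t \- v s) @[t --> within `[0, T] (nbhs s)] --> 0%E).

Definition C_H1w (T : R) (v : R -> R * R -> R) : Prop :=
  (forall t : R, 0 <= t <= T -> H1 (v t)) /\
  (forall l, H1_dual l -> {within `[0, T], continuous (fun t => l (v t))}).

(* The norm `|A| of the library is the maximum of the entries. *)
Definition eucl_norm (A : 'M[R]_2) : R :=
  Num.sqrt (\sum_i \sum_j `|A i j| ^+ 2).

Definition Linfty_norm (A : R * R -> 'M[R]_2) : \bar R :=
  'N[torus_measure]_(+oo)[EFin \o (eucl_norm \o A)]%E.

(* Since L^oo(T^2) is not separable, measurability in time is understood in the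
   weak-* sense, L^oo(T^2) being the dual of L^1(T^2). *)
Definition Linfty_Linfty (T : R) (sigma : R -> R * R -> 'M[R]_2) : Prop :=
  [/\ forall i j g, torus_L 1%:E g ->
        measurable_fun `]0, T[
          (fun t => \int[torus_measure]_x (sigma t x i j * g x)),
      {ae lebesgue_measure, forall t : R, 0 < t < T ->
        forall i j, torus_L +oo%E (fun x => sigma t x i j)} &
      exists M : R, {ae lebesgue_measure, forall t : R, 0 < t < T ->
        (Linfty_norm (sigma t) <= M%:E)%E}].

Definition grad (u : R * R -> 'rV[R]_2) (x : R * R) : 'M[R]_2 :=
  \matrix_(i, j) weak_deriv j (fun y => u y 0 i) x.

Definition symgrad (u : R * R -> 'rV[R]_2) (x : R * R) : 'M[R]_2 :=
  2^-1 *: (grad u x + (grad u x)^T).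

Definition Deps (eps : R) (u : R * R -> 'rV[R]_2) (x : R * R) : R :=
  Num.sqrt (eucl_norm (symgrad u x) ^+ 2 + eps ^+ 2).

Definition relaxation (P eps : R) (u : R * R -> 'rV[R]_2)
    (sigma : R * R -> 'M[R]_2) (x : R * R) : 'M[R]_2 :=
  (4 * Deps eps u x / P) *: (sigma x - (2^-1 * \tr (sigma x)) *: 1%:M)
  + (Deps eps u x / (2 * P) * \tr (sigma x)) *: 1%:M
  + (Deps eps u x / 2) *: 1%:M.

Definition space_dir (i : 'I_2) : (R * R) * R := (torus_dir i, 0).

Definition time_dir : (R * R) * R := (0, 1).

(* C^oo functions with compact support in T^2 x (0,T). *)
Definition spacetime_test (T : R) (phi : (R * R) * R -> R) : Prop :=
  [/\ smooth (time_dir :: [seq space_dir i | i : 'I_2]) phi,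
      forall t, torus_periodic (fun x => phi (x, t)) &
      exists a b : R, [/\ 0 < a, b < T &
        forall x t, ~~ (a <= t <= b) -> phi (x, t) = 0]].

(* The equation
     (1/E) d_t sigma + relaxation P eps u sigma = D(u)
   in the sense of distributions on T^2 x (0,T).  The inner integral depends
   only on the almost everywhere classes of sigma(t) and D(u(t)). *)
Definition stress_equation (T P E eps : R) (u : R -> R * R -> 'rV[R]_2)
    (sigma : R -> R * R -> 'M[R]_2) : Prop :=
  forall phi, spacetime_test T phi -> forall i j,
    \int[lebesgue_measure]_(t in `]0, T[) \int[torus_measure]_x
      (- (E^-1 * sigma t x i j * 'D_time_dir phi (x, t))
       + relaxation P eps (u t) (sigma t) x i j * phi (x, t)
       - symgrad (u t) x i j * phi (x, t)) = 0.

End torus.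

(* Main.v *)
Require Import Defs.
From mathcomp Require Import all_boot all_order all_algebra.
From mathcomp Require Import all_classical all_reals all_analysis.
From mathcomp Require Import measurable_realfun ess_sup_inf ring lra.
Import Order.TTheory GRing.Theory Num.Theory.
Import numFieldNormedType.Exports.
Local Open Scope classical_set_scope.
Local Open Scope ring_scope.
Set Implicit Arguments.
Unset Strict Implicit.
Unset Printing Implicit Defensive.

(** The equation contains no spatial derivative of [sigma]: at a given point it
    is an ordinary differential equation driven by the strain [D(u)].  Taking
    its scalar product with [sigma] gives, since [|D(u)| <= D_eps] and
    [|Tr sigma| <= 2 |sigma|],
    [[
      d/dt |sigma|^2 / (2 E) <= D_eps |sigma| (2 - |sigma| / P)
    ]]
    so that [|sigma|] cannot grow where it exceeds [2 P]
    ([relaxation_dissipative]).  With [M = ||sigma_0|| + 2 P] the initial datum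
    lies in the ball of radius [M], and the solution never leaves it.

    As [sigma] is only continuous in time with values in [L^2], and solves the
    equation in the sense of distributions, this is carried out on the total
    excess [Phi t], the integral over the torus of [max (|sigma t| - M) 0].
    This integrand is a convex function of [sigma t] with a bounded subgradient
    [g t], so that [Phi t - Phi s <= <g t, sigma t - sigma s>]
    ([excess_subgradient]).  The rate [f] in [E^-1 * sigma' + f = 0] is
    continuous in time with values in [L^1] ([stress_rate_continuous]), being
    made of products of two families continuous in [L^2]; hence for [s] and [t]
    close to each other the right-hand side is [- E (t - s) <g t, f t>] up to an
    error small compared to [t - s], and [<g t, f t>] is nonnegative by
    dissipation.  An inequality
    [Phi t - Phi s <= e (t - s)] that holds locally for every positive [e] holds
    globally ([local_increments_nonincreasing]), whence [Phi t <= Phi 0 = 0].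

    The increment of [<g, sigma>] for a bounded field [g] that is merely
    measurable comes from the weak equation in two steps.  Products of smooth
    functions of one variable, built from [exp (- 1 / y)], approximate the
    indicators of rectangles of the torus, and a Dynkin class argument then
    gives every bounded [g] ([test_against_eq0]).  In time, a smooth cut-off of
    the indicator of [s, t] recovers the increment over that interval
    ([weak_derivative_increment]).  The same density shows that weak
    derivatives are unique almost everywhere, hence additive, which turns
    continuity of [u] in [H^1] into continuity of the strain in [L^2]. *)

(** * Smooth functions of one variable *)

Section smooth_line.
Variable R : realType.
Implicit Types (f g : R -> R) (n m : nat).

(** Recursion on the derivative, rather than on the order of an iterated
    derivative, turns the product and chain rules into one-step inductions. *)
Fixpoint times_differentiable n f : Prop :=
  if n is m.+1
  then (forall x, derivable f x 1) /\ times_differentiable m (derive1 f)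
  else True.

Definition smooth_line f := forall n, times_differentiable n f.

Lemma derive1_is_derive f (df : R -> R) :
  (forall x : R, is_derive x 1 f (df x)) -> derive1 f = df.
Proof. by move=> fdf; apply/funext => x; rewrite derive1E derive_val. Qed.

Lemma times_differentiableS n f :
  times_differentiable n.+1 f -> times_differentiable n f.
Proof. by elim: n f => [//|n IH] f [df /IH]. Qed.

Lemma smooth_line_derivable f : smooth_line f -> forall x, derivable f x 1.
Proof. by move=> /(_ 1%N) []. Qed.

Lemma smooth_line_derive1 f : smooth_line f -> smooth_line (derive1 f).
Proof. by move=> sf n; have [] := sf n.+1. Qed.

Lemma smooth_line_derive1n n f : smooth_line f -> smooth_line (derive1n n f).
Proof.
elim: n => [//|n IH] /IH sf.
by rewrite derive1nS; exact: smooth_line_derive1.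
Qed.

Lemma smooth_line_continuous f : smooth_line f -> continuous f.
Proof.
move=> sf x; apply: differentiable_continuous.
exact/derivable1_diffP/smooth_line_derivable.
Qed.

Lemma times_differentiable_cst n a : times_differentiable n (cst a : R -> R).
Proof.
elim: n a => [//|n IH] a; split=> [x|]; first exact: derivable_cst.
rewrite (_ : derive1 _ = cst 0) //.
by apply: derive1_is_derive => x; exact: is_derive_cst.
Qed.

Lemma times_differentiableD n f g : times_differentiable n f ->
  times_differentiable n g -> times_differentiable n (fun x => f x + g x).
Proof.
elim: n f g => [//|n IH] f g [df cf] [dg cg]; split=> [x|].
  exact: derivableD.
rewrite (_ : derive1 _ = fun x => derive1 f x + derive1 g x); first exact: IH.
apply/funext => x; rewrite !derive1E.
by rewrite (deriveD (df x) (dg x)).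
Qed.

Lemma times_differentiableM n f g : times_differentiable n f ->
  times_differentiable n g -> times_differentiable n (fun x => f x * g x).
Proof.
elim: n f g => [//|n IH] f g cSf cSg.
have [df cf] := cSf; have [dg cg] := cSg; split=> [x|].
  exact: derivableM.
rewrite (_ : derive1 _ = fun x => f x * derive1 g x + g x * derive1 f x).
  by apply: times_differentiableD; apply: IH => //; exact: times_differentiableS.
by apply/funext => x; rewrite !derive1E (deriveM (df x) (dg x)).
Qed.

Lemma times_differentiable_comp n f g : times_differentiable n f ->
  times_differentiable n g -> times_differentiable n (fun x => f (g x)).
Proof.
elim: n f g => [//|n IH] f g [df cf] cSg; have [dg cg] := cSg.
split=> [x|].
  apply/derivable1_diffP; apply: differentiable_comp => //;
  exact/derivable1_diffP.
rewrite (_ : derive1 _ = fun x => derive1 f (g x) * derive1 g x).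
  apply: times_differentiableM => //; apply: IH => //.
  exact: times_differentiableS.
by apply/funext => x; rewrite -(derive1_comp (dg x) (df _)).
Qed.

Lemma smooth_line_cst a : smooth_line (cst a : R -> R).
Proof. by move=> n; exact: times_differentiable_cst. Qed.

Lemma smooth_line_id : smooth_line (id : R -> R).
Proof.
case=> [//|n]; split=> [x|]; first exact: derivable_id.
by rewrite (_ : derive1 (id : R -> R) = cst (1 : R));
  [exact: smooth_line_cst|apply: derive1_is_derive => x; exact: is_derive_id].
Qed.

Lemma smooth_lineD f g : smooth_line f -> smooth_line g ->
  smooth_line (fun x => f x + g x).
Proof. by move=> sf sg n; exact: times_differentiableD. Qed.

Lemma smooth_lineM f g : smooth_line f -> smooth_line g ->
  smooth_line (fun x => f x * g x).
Proof. by move=> sf sg n; exact: times_differentiableM. Qed.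

Lemma smooth_line_comp f g : smooth_line f -> smooth_line g ->
  smooth_line (fun x => f (g x)).
Proof. by move=> sf sg n; exact: times_differentiable_comp. Qed.

Lemma smooth_lineZ a f : smooth_line f -> smooth_line (fun x => a * f x).
Proof. by move=> sf; apply: smooth_lineM sf; exact: smooth_line_cst. Qed.

Lemma smooth_lineN f : smooth_line f -> smooth_line (fun x => - f x).
Proof.
move=> sf; rewrite (_ : (fun x => - f x) = (fun x => -1 * f x)).
  exact: smooth_lineZ.
by apply/funext => x; rewrite mulN1r.
Qed.

Lemma smooth_lineB f g : smooth_line f -> smooth_line g ->
  smooth_line (fun x => f x - g x).
Proof. by move=> sf sg; apply: smooth_lineD => //; exact: smooth_lineN. Qed.

Lemma smooth_line_sin : smooth_line (@sin R).
Proof.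
suff H n : times_differentiable n (@sin R) /\ times_differentiable n (@cos R).
  by move=> n; have [] := H n.
elim: n => [//|n [IHs IHc]]; split; split=> [x|].
- exact: ex_derive.
- by rewrite (derive1_is_derive (@is_derive_sin R)).
- exact: ex_derive.
- rewrite (derive1_is_derive (@is_derive_cos R)).
  rewrite (_ : (fun x => - sin x) = (fun x => -1 * sin x)).
    by apply: times_differentiableM => //; exact: times_differentiable_cst.
  by apply/funext => x; rewrite mulN1r.
Qed.

(** This is how the flat functions below are differentiated at the one point
    where they are not given by a formula. *)
Lemma is_derive_quadratic f C :
  (forall y, `|f y| <= C * y ^+ 2) -> is_derive (0 : R) 1 f 0.
Proof.
move=> fC.
have f0 : f 0 = 0.
  by apply/eqP; rewrite -normr_le0 (le_trans (fC 0))// expr0n mulr0.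
suff H : h^-1 *: ((f \o shift 0) (h *: (1 : R)) - f 0) @[h --> 0^'] --> (0 : R).
  by apply: DeriveDef; [apply/cvg_ex; exists 0|exact: cvg_lim H].
have C0 : 0 <= C by have := le_trans (normr_ge0 _) (fC 1); rewrite expr1n mulr1.
apply/cvgr0Pnorm_le => e e0; near=> h.
have h0 : h != 0 by near: h; exact: nbhs_dnbhs_neq.
rewrite /= f0 subr0 addr0 [h *: _]mulr1 [_ *: _]mulrC normrM normfV.
rewrite ler_pdivrMr ?normr_gt0//.
apply: (le_trans (fC h)); rewrite -real_normK ?num_real// expr2 mulrA.
rewrite ler_wpM2r// (@le_trans _ _ ((C + 1) * `|h|)) ?ler_wpM2r ?lerDl//.
rewrite mulrC -ler_pdivlMr ?ltr_wpDl//.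
near: h; apply: dnbhs0_le; rewrite divr_gt0// ltr_wpDl//.
Unshelve. all: by end_near. Qed.

(** The functions [y^-m * exp (- 1/y)], extended by zero, are a family stable
    under differentiation up to linear combinations: this is why the flat
    function [flat 0] is smooth across the origin. *)
Definition flat m (y : R) : R := if 0 < y then y^-1 ^+ m * expR (- y^-1) else 0.

(** The exponential dominates the power [(1/y) ^ (m + 2)]. *)
Lemma flat_le m y : 0 < y -> 0 <= flat m y <= (m.+2)`!%:R * y ^+ 2.
Proof.
move=> y0; rewrite /flat y0; have z0 : 0 < y^-1 by rewrite invr_gt0.
apply/andP; split.
  by rewrite mulr_ge0 ?expR_ge0// exprn_ge0// ltW.
have H : y^-1 ^+ m.+2 / (m.+2)`!%:R <= expR y^-1.
  by apply: le_trans (expR_ge1Dxn m.+1 (ltW z0)); rewrite lerDr.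
have f0 : 0 < (m.+2)`!%:R :> R by rewrite ltr0n fact_gt0.
rewrite expRN ler_pdivrMr ?expR_gt0//.
move: H; rewrite ler_pdivrMr// => H.
have -> : y^-1 ^+ m = y ^+ 2 * y^-1 ^+ m.+2.
  by rewrite -[m.+2]addn2 exprD mulrCA -exprMn mulfV ?gt_eqF// expr1n mulr1.
rewrite [leRHS]mulrAC [leRHS]mulrC ler_pM2l ?exprn_gt0//.
by rewrite mulrC.
Qed.

Lemma is_derive_flat m (y : R) :
  is_derive y 1 (flat m) (flat m.+2 y - m%:R * flat m.+1 y).
Proof.
have [y0|y0|->] := ltgtP y 0.
- rewrite /flat !ltNge (ltW y0)/= mulr0 subr0.
  apply: (@near_eq_is_derive _ _ _ (cst 0)).
    near=> z; rewrite /= ifF//; apply/negbTE; rewrite -leNgt ltW//.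
    by near: z; exact: lt_nbhsl.
- rewrite /flat y0.
  have dv : is_derive y 1 (fun z : R => z^-1) (- y ^- 2).
    have dy := @derivable_id R R^o y 1.
    have yn0 := lt0r_neq0 y0.
    apply: DeriveDef; first exact: (@derivableV R R^o id _ _ yn0 dy).
    by rewrite (@deriveV R R^o id _ _ yn0 dy) derive_id [_ *: _]mulr1.
  have dX : is_derive y 1 (fun z : R => z^-1 ^+ m)
      ((m%:R * y^-1 ^+ m.-1) * - y ^- 2).
    have dm : is_derive (y^-1) 1 (fun z : R => z ^+ m) (m%:R * y^-1 ^+ m.-1).
      apply: DeriveDef; first exact: exprn_derivable.
      by rewrite exp_derive [_ *: _]mulr1.
    exact: (is_derive1_comp dm dv).
  have dN : is_derive y 1 (fun z : R => - z^-1) (y ^- 2).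
    by apply: is_derive_eq (is_deriveN dv) _; rewrite opprK.
  have dE : is_derive y 1 (fun z : R => expR (- z^-1)) (expR (- y^-1) * y ^- 2).
    exact: (is_derive1_comp (is_derive_expR _) dN).
  have dF : is_derive y 1 (fun z : R => z^-1 ^+ m * expR (- z^-1)) _ :=
    is_deriveM dX dE.
  apply: is_derive_eq.
    apply: near_eq_is_derive dF.
    near=> z; rewrite /flat ifT//.
    by near: z; exact: lt_nbhsr.
  rewrite -!exprVn /GRing.scale/= -/(y^-1) !exprS.
  by case: m {dX dF} => [|m]; rewrite ?exprS /=; ring.
- rewrite {2 3}/flat ltxx mulr0 subr0.
  apply: (is_derive_quadratic (C := (m.+2)`!%:R)).
  move=> z; case: (ltP 0 z) => z0; last first.
    by rewrite /flat ltNge z0/= normr0 mulr_ge0 ?sqr_ge0.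
  by have /andP[f0 ?] := flat_le m z0; rewrite ger0_norm.
Unshelve. all: by end_near. Qed.

Lemma times_differentiable_flat n m : times_differentiable n (flat m).
Proof.
elim: n m => [//|n IH] m; split=> [x|].
  by have [] := is_derive_flat m x.
rewrite (derive1_is_derive (is_derive_flat m)).
rewrite (_ : (fun x => _) = (fun x => flat m.+2 x + - m%:R * flat m.+1 x)).
  apply: times_differentiableD => //; apply: times_differentiableM => //.
  exact: times_differentiable_cst.
by apply/funext => x; rewrite mulNr.
Qed.

Definition bump := flat 0.

Lemma smooth_line_bump : smooth_line bump.
Proof. by move=> n; exact: times_differentiable_flat. Qed.

Lemma bump_le0 y : y <= 0 -> bump y = 0.
Proof. by move=> y0; rewrite /bump /flat ltNge y0. Qed.

Lemma bumpE y : 0 < y -> bump y = expR (- y^-1).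
Proof. by move=> y0; rewrite /bump /flat y0 expr0 mul1r. Qed.

Lemma bump_ge0 y : 0 <= bump y.
Proof. by case: (leP y 0) => y0; [rewrite bump_le0|rewrite bumpE// expR_ge0]. Qed.

Lemma bump_le1 y : bump y <= 1.
Proof.
case: (leP y 0) => y0; first by rewrite bump_le0// ler01.
by rewrite bumpE// -expR0 ler_expR oppr_le0 invr_ge0 ltW.
Qed.

Lemma bump_gt0 y : 0 < y -> 0 < bump y.
Proof. by move=> y0; rewrite bumpE ?expR_gt0. Qed.

Lemma bump_nondecreasing y z : y <= z -> bump y <= bump z.
Proof.
move=> yz; case: (leP y 0) => y0; first by rewrite (bump_le0 y0) bump_ge0.
have z0 := lt_le_trans y0 yz.
by rewrite !bumpE// ler_expR lerN2 lef_pV2.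
Qed.

(** Composing the flat function with its own reflection gives a transition
    from [0] to [1] without dividing by a partition of unity. *)
Definition step (y : R) : R := bump (bump 1 - bump (1 - y)) / bump (bump 1).

Let bump1_gt0 : 0 < bump (bump 1).
Proof. by rewrite !bump_gt0. Qed.

Lemma smooth_line_step : smooth_line step.
Proof.
apply: smooth_lineM; last exact: smooth_line_cst.
apply: smooth_line_comp; first exact: smooth_line_bump.
apply: smooth_lineB; first exact: smooth_line_cst.
apply: smooth_line_comp; first exact: smooth_line_bump.
by apply: smooth_lineB; [exact: smooth_line_cst|exact: smooth_line_id].
Qed.

Lemma step_le0 y : y <= 0 -> step y = 0.
Proof.
move=> y0; rewrite /step bump_le0 ?mul0r// subr_le0.
by apply: bump_nondecreasing; rewrite lerBrDr gerDl.
Qed.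

Lemma step_ge1 y : 1 <= y -> step y = 1.
Proof.
move=> y1; rewrite /step [bump (1 - y)]bump_le0 ?subr_le0// subr0.
by rewrite divff// gt_eqF.
Qed.

Lemma step_nondecreasing y z : y <= z -> step y <= step z.
Proof.
move=> yz; rewrite ler_pM2r ?invr_gt0//.
by apply/bump_nondecreasing/lerB => //; apply/bump_nondecreasing/lerB.
Qed.

Lemma step_ge0 y : 0 <= step y.
Proof. by rewrite divr_ge0 ?bump_ge0. Qed.

Lemma step_le1 y : step y <= 1.
Proof.
rewrite -(step_ge1 (y := Num.max y 1)) ?le_max ?lexx ?orbT//.
by rewrite step_nondecreasing// le_max lexx.
Qed.

End smooth_line.

(** * Products of one-variable functions as test functions *)

Section test_functions.
Variable R : realType.

(** A directional derivative only sees the restriction to a line. *)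
Lemma is_derive_along (V W : normedModType R) (f : V -> R) (g : W -> R)
    x v y w (c : R) :
  (forall h : R, f (h *: v + x) = c * g (h *: w + y)) ->
  derivable g y w -> is_derive x v f (c * 'D_w g y).
Proof.
move=> fg dg.
have fx : f x = c * g y by have := fg 0; rewrite !scale0r !add0r.
have E : (fun h : R => h^-1 *: ((f \o shift x) (h *: v) - f x)) =
    (fun h : R => c *: (h^-1 *: ((g \o shift y) (h *: w) - g y))).
  apply/funext => h; rewrite /= fg fx -mulrBr /GRing.scale/=; ring.
have cvgf : h^-1 *: ((f \o shift x) (h *: v) - f x) @[h --> 0^'] -->
    (c * 'D_w g y).
  by rewrite E; apply: cvgZ; [exact: cvg_cst|exact: dg].
by apply: DeriveDef; [apply/cvg_ex; exists (c * 'D_w g y)|exact: cvg_lim cvgf].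
Qed.

Definition tensor (p q : R -> R) (x : R * R) : R := p x.1 * q x.2.

Lemma torus_dir_mem v : v \in [seq @torus_dir R i | i : 'I_2] ->
  v = (1, 0) \/ v = (0, 1).
Proof.
move=> /mapP[i _ ->]; rewrite /torus_dir.
by case: ifP => _; [left|right].
Qed.

Lemma mem_torus_dir i : @torus_dir R i \in [seq @torus_dir R i | i : 'I_2].
Proof. by apply/mapP; exists i; rewrite ?mem_enum. Qed.

Lemma is_derive_tensor1 p q (x : R * R) : smooth_line p ->
  is_derive x (1, 0) (tensor p q) (tensor (derive1 p) q x).
Proof.
move=> sp; rewrite /tensor mulrC derive1E; apply: is_derive_along.
  by move=> h /=; rewrite mulrC scaler0 add0r.
exact: smooth_line_derivable.
Qed.

Lemma is_derive_tensor2 p q (x : R * R) : smooth_line q ->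
  is_derive x (0, 1) (tensor p q) (tensor p (derive1 q) x).
Proof.
move=> sq; rewrite /tensor derive1E; apply: is_derive_along.
  by move=> h /=; rewrite scaler0 add0r.
exact: smooth_line_derivable.
Qed.

Lemma iter_deriv_tensor p q s : smooth_line p -> smooth_line q ->
  {subset s <= [seq @torus_dir R i | i : 'I_2]} ->
  exists a b, iter_deriv s (tensor p q) = tensor (derive1n a p) (derive1n b q).
Proof.
move=> sp sq; elim: s => [_|v s IH sD]; first by exists 0%N, 0%N.
have [|a [b sE]] := IH; first by move=> w ws; apply: sD; rewrite inE ws orbT.
have [->|->] : v = (1, 0) \/ v = (0, 1).
  by apply: torus_dir_mem; apply: sD; rewrite mem_head.
- exists a.+1, b; rewrite /= -/(iter_deriv _ _) sE; apply/funext => x.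
  have := is_derive_tensor1 (derive1n b q) x (smooth_line_derive1n a sp).
  by rewrite -derive1nS => /@derive_val.
- exists a, b.+1; rewrite /= -/(iter_deriv _ _) sE; apply/funext => x.
  have := is_derive_tensor2 (derive1n a p) x (smooth_line_derive1n b sq).
  by rewrite -derive1nS => /@derive_val.
Qed.

Lemma continuous_tensor p q : continuous p -> continuous q ->
  continuous (tensor p q).
Proof.
move=> cp cq x; apply: cvgM.
  by apply: continuous_comp; [exact: cvg_fst|exact: cp].
by apply: continuous_comp; [exact: cvg_snd|exact: cq].
Qed.

Lemma torus_test_tensor p q : smooth_line p -> smooth_line q ->
  (forall x, p (x + 1) = p x) -> (forall x, q (x + 1) = q x) ->
  torus_test (tensor p q).
Proof.
move=> sp sq pp pq; split.
  move=> s sD; have [a [b ->]] := iter_deriv_tensor sp sq sD.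
  have spa := smooth_line_derive1n a sp; have sqb := smooth_line_derive1n b sq.
  split; first by apply: continuous_tensor; exact: smooth_line_continuous.
  move=> v x /torus_dir_mem[] ->.
    by have [] := is_derive_tensor1 (derive1n b q) x spa.
  by have [] := is_derive_tensor2 (derive1n a p) x sqb.
move=> i [x1 x2]; rewrite /tensor /torus_dir.
by case: ifP => _ /=; rewrite ?addr0 ?pp ?pq.
Qed.

Definition spacetime_tensor (phi : R * R -> R) (chi : R -> R)
  (z : (R * R) * R) : R := phi z.1 * chi z.2.

Lemma is_derive_space (phi : R * R -> R) chi v z : derivable phi z.1 v ->
  is_derive z (v, 0) (spacetime_tensor phi chi)
    (spacetime_tensor ('D_v phi) chi z).
Proof.
move=> dphi; rewrite /spacetime_tensor mulrC; apply: is_derive_along => //.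
by move=> h /=; rewrite mulrC scaler0 add0r.
Qed.

Lemma is_derive_time phi chi z : smooth_line chi ->
  is_derive z (@time_dir R) (spacetime_tensor phi chi)
    (spacetime_tensor phi (derive1 chi) z).
Proof.
move=> schi; rewrite /spacetime_tensor derive1E; apply: is_derive_along.
  by move=> h /=; rewrite scaler0 add0r.
exact: smooth_line_derivable.
Qed.

Lemma spacetime_test_tensor (T a b : R) phi chi :
  torus_test phi -> smooth_line chi -> 0 < a -> b < T ->
  (forall t, ~~ (a <= t <= b) -> chi t = 0) ->
  spacetime_test T (spacetime_tensor phi chi).
Proof.
move=> [sphi pphi] schi a0 bT chi0; split; last 2 first.
- by move=> t i x; rewrite /spacetime_tensor /= pphi.
- exists a, b; split=> // x t tab.
  by rewrite /spacetime_tensor /= chi0// mulr0.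
have dirP v : v \in @time_dir R :: [seq @space_dir R i | i : 'I_2] ->
    v = @time_dir R \/
    exists2 w, w \in [seq @torus_dir R i | i : 'I_2] & v = (w, 0).
  rewrite inE => /orP[/eqP ->|/mapP[i _ ->]]; first by left.
  by right; exists (torus_dir R i) => //; exact: mem_torus_dir.
have iterE s : {subset s <= @time_dir R :: [seq @space_dir R i | i : 'I_2]} ->
    exists s' c, {subset s' <= [seq @torus_dir R i | i : 'I_2]} /\
      iter_deriv s (spacetime_tensor phi chi) =
      spacetime_tensor (iter_deriv s' phi) (derive1n c chi).
  elim: s => [_|v s IH sD]; first by exists [::], 0%N.
  have [|s' [c [s'D sE]]] := IH.
    by move=> w ws; apply: sD; rewrite inE ws orbT.
  have [|->|[w wD ->]] := dirP v; first by apply: sD; rewrite mem_head.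
    exists s', c.+1; split => //; rewrite /= -/(iter_deriv _ _) sE.
    apply/funext => z.
    have := is_derive_time (iter_deriv s' phi) z (smooth_line_derive1n c schi).
    by rewrite -derive1nS => /@derive_val.
  exists (w :: s'), c; split.
    by move=> x; rewrite inE => /orP[/eqP ->//|]; exact: s'D.
  rewrite /= -!/(iter_deriv _ _) sE; apply/funext => z.
  have [_ dphi] := sphi _ s'D.
  by have [] := is_derive_space (derive1n c chi) (dphi _ z.1 wD).
move=> s sD; have [s' [c [s'D ->]]] := iterE _ sD.
have schic := smooth_line_derive1n c schi; have [cphi dphi] := sphi _ s'D.
split.
  move=> z; apply: cvgM.
    by apply: continuous_comp; [exact: cvg_fst|exact: cphi].
  apply: continuous_comp; first exact: cvg_snd.
  exact: smooth_line_continuous.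
move=> v z /dirP[->|[w wD ->]].
  by have [] := is_derive_time (iter_deriv s' phi) z schic.
by have [] := is_derive_space (derive1n c chi) (dphi _ z.1 wD).
Qed.

(** For [a] in [0, 1[ this function is positive, within one period, exactly on
    the arc from [a] to [1]; being a product of two antiperiodic factors it is
    periodic. *)
Definition arc_sign (a x : R) : R := sin (pi * x) * sin (pi * (x - a)).

Lemma arc_sign_periodic a x : arc_sign a (x + 1) = arc_sign a x.
Proof.
rewrite /arc_sign addrAC !mulrDr !mulr1 !sinDpi.
by rewrite mulrNN -mulrDr.
Qed.

Lemma arc_sign_gt0 (a x : R) : 0 <= a < 1 -> 0 <= x < 1 ->
  (0 < arc_sign a x) = (a < x).
Proof.
move=> /andP[a0 a1] /andP[x0 x1]; have p0 := pi_gt0 R; rewrite /arc_sign.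
have sin_gt0 (y : R) : 0 < y < 1 -> 0 < sin (pi * y).
  move=> /andP[y0 y1]; apply: sin_gt0_pi; apply/andP; split.
    exact: mulr_gt0.
  by rewrite gtr_pMr.
have [ax|xa] := ltP a x.
  by rewrite mulr_gt0 ?sin_gt0//; apply/andP; split; lra.
apply/negbTE; rewrite -leNgt.
have [->|xn0] := eqVneq x 0; first by rewrite mulr0 sin0 mul0r.
have {}x0 : 0 < x by rewrite lt0r xn0.
rewrite pmulr_rle0 ?sin_gt0 ?x0//.
have [->|xna] := eqVneq x a; first by rewrite subrr mulr0 sin0.
rewrite -opprB mulrN sinN oppr_le0 ltW// sin_gt0// subr_gt0 lt_neqAle xna xa/=.
lra.
Qed.

(** [bump (n * y)] tends to [1] when [0 < y], and vanishes otherwise.  Rays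
    starting outside of [0, 1[ cut the period trivially. *)
Lemma ray_approximation (a : R) : exists p : nat -> R -> R,
  [/\ forall n, smooth_line (p n), forall n x, p n (x + 1) = p n x,
      forall n x, 0 <= p n x <= 1 &
      forall x : R, 0 <= x < 1 -> p n x @[n --> \oo] --> ((a < x)%R%:R : R) ].
Proof.
have [a1|a1] := leP 1 a.
  exists (fun _ => cst 0); split=> //.
  - by move=> _; exact: smooth_line_cst.
  - by move=> n x; rewrite /= lexx ler01.
  - move=> x /andP[_ x1]; rewrite ltNge (le_trans (ltW x1) a1)/=.
    exact: cvg_cst.
have [a0|a0] := ltP a 0.
  exists (fun _ => cst 1); split=> //.
  - by move=> _; exact: smooth_line_cst.
  - by move=> n x; rewrite /= lexx ler01.
  - by move=> x /andP[x0 _]; rewrite (lt_le_trans a0 x0); exact: cvg_cst.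
exists (fun n x => bump (n%:R * arc_sign a x)); split.
- move=> n; apply: smooth_line_comp; first exact: smooth_line_bump.
  apply: smooth_lineZ; apply: smooth_lineM; apply: smooth_line_comp;
    try exact: smooth_line_sin; apply: smooth_lineZ; first exact: smooth_line_id.
  by apply: smooth_lineB; [exact: smooth_line_id|exact: smooth_line_cst].
- by move=> n x; rewrite arc_sign_periodic.
- by move=> n x; rewrite bump_ge0 bump_le1.
move=> x x01; rewrite -(arc_sign_gt0 (a := a) _ x01) ?a0//.
have [y0|y0] := ltP 0 (arc_sign a x); last first.
  rewrite (_ : (fun n => _) = cst 0); first exact: cvg_cst.
  by apply/funext => n; rewrite bump_le0// mulr_ge0_le0.
rewrite -(cvg_shiftS (fun n => bump (n%:R * arc_sign a x))) /=.
have E n : bump (n.+1%:R * arc_sign a x) =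
    expR (- (n.+1%:R^-1 * (arc_sign a x)^-1)).
  by rewrite (bumpE (mulr_gt0 (ltr0Sn R n) y0)) invfM.
under eq_fun do rewrite E.
have : expR (- (n.+1%:R^-1 * (arc_sign a x)^-1)) @[n --> \oo] -->
    expR (- (0 * (arc_sign a x)^-1)).
  apply: continuous_cvg; first exact: continuous_expR.
  apply: cvgN; apply: cvgM; [exact: cvg_harmonic|exact: cvg_cst].
by rewrite mul0r oppr0 expR0.
Qed.

End test_functions.

(** * Integrals of real functions *)

Section real_integrals.
Context d (X : measurableType d) (R : realType).
Variable mu : {measure set X -> \bar R}.
Implicit Types (f g : X -> R).

Definition integrable1 f := mu.-integrable setT (EFin \o f).

Lemma integrable1_measurable f : integrable1 f -> measurable_fun setT f.
Proof. by move=> /measurable_int/measurable_EFinP. Qed.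

Lemma le_integrable1 f g : measurable_fun setT f ->
  (forall x, `|f x| <= g x) -> integrable1 g -> integrable1 f.
Proof.
move=> mf fg; apply: le_integrable => //; first exact/measurable_EFinP.
by move=> x _ /=; rewrite lee_fin (le_trans (fg x))// ler_norm.
Qed.

Lemma integrable1D f g : integrable1 f -> integrable1 g ->
  integrable1 (fun x => f x + g x).
Proof.
move=> f1 g1; have := integrableD measurableT f1 g1.
by apply: eq_integrable => // x _.
Qed.

Lemma integrable1B f g : integrable1 f -> integrable1 g ->
  integrable1 (fun x => f x - g x).
Proof.
move=> f1 g1; have := integrableB measurableT f1 g1.
by apply: eq_integrable => // x _.
Qed.

Lemma integrable1Z c f : integrable1 f -> integrable1 (fun x => c * f x).
Proof.
move=> f1; have := integrableZl measurableT c f1.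
by apply: eq_integrable => // x _.
Qed.

Lemma integrable1_norm f : integrable1 f -> integrable1 (fun x => `|f x|).
Proof. exact: integrable_norm. Qed.

Lemma integrable1_Mbounded f g C : integrable1 f -> measurable_fun setT g ->
  (forall x, `|g x| <= C) -> integrable1 (fun x => f x * g x).
Proof.
move=> f1 mg gC; apply: (le_integrable1 (g := fun x => C * `|f x|)).
- by apply: measurable_funM => //; exact: integrable1_measurable.
- by move=> x; rewrite normrM mulrC ler_wpM2r.
- by apply: integrable1Z; exact: integrable1_norm.
Qed.

Lemma integrable1_sum (I : Type) (s : seq I) (F : I -> X -> R) :
  (forall i, integrable1 (F i)) -> integrable1 (fun x => \sum_(i <- s) F i x).
Proof.
move=> F1; elim: s => [|i s IH].
  have := integrable0 mu [set: X].
  by apply: eq_integrable => // x _ /=; rewrite big_nil.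
have := integrable1D (F1 i) IH.
by apply: eq_integrable => // x _ /=; rewrite big_cons.
Qed.

Lemma Rintegral_sum (I : Type) (s : seq I) (F : I -> X -> R) :
  (forall i, integrable1 (F i)) ->
  \int[mu]_x (\sum_(i <- s) F i x) = \sum_(i <- s) \int[mu]_x F i x.
Proof.
move=> F1; elim: s => [|i s IH].
  rewrite big_nil (_ : (fun x => _) = cst 0) ?Rintegral_cst ?mul0r//.
  by apply/funext => x; rewrite big_nil.
rewrite big_cons -IH -RintegralD//; [|exact: F1|exact: integrable1_sum].
by apply: eq_Rintegral => x _; rewrite big_cons.
Qed.

Lemma Rintegral_dominated_cvg D (F : nat -> X -> R) f g :
  measurable D -> (forall n, measurable_fun D (F n)) -> measurable_fun D f ->
  {ae mu, forall x, D x -> F n x @[n --> \oo] --> f x} ->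
  mu.-integrable D (EFin \o g) ->
  {ae mu, forall x n, D x -> `|F n x| <= g x} ->
  \int[mu]_(x in D) F n x @[n --> \oo] --> \int[mu]_(x in D) f x.
Proof.
move=> mD mF mf Ff g1 Fg.
have [| | | | |f1 _ If] := @dominated_convergence _ _ _ mu D mD
    (fun n => EFin \o F n) (EFin \o f) (EFin \o g).
- by move=> n; exact/measurable_EFinP.
- exact/measurable_EFinP.
- apply: filterS Ff => x + Dx => /(_ Dx) Fx.
  by apply: cvg_EFin => //; exact: nearW.
- exact: g1.
- by apply: filterS Fg => x Fgx n Dx /=; rewrite lee_fin Fgx.
rewrite /Rintegral; apply: fine_cvg; rewrite fineK//.
exact: integrable_fin_num.
Qed.

Lemma ae_eq0_of_Rintegral_norm f : integrable1 f ->
  \int[mu]_x `|f x| <= 0 -> {ae mu, forall x, f x = 0}.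
Proof.
move=> f1 If.
have If0 : (\int[mu]_x `|(EFin \o f) x| = 0)%E.
  have fin : (\int[mu]_x `|(EFin \o f) x| \is a fin_num)%E.
    by apply: integrable_fin_num => //; exact: integrable1_norm f1.
  rewrite -(fineK fin); congr EFin; apply/eqP; rewrite eq_le.
  by rewrite [X in X && _]If /= fine_ge0// integral_ge0.
have mf : measurable_fun setT (EFin \o f) by exact: measurable_int f1.
have := (ae_eq_integral_abs mu measurableT mf).1 If0.
by apply: filterS => x /= /(_ I)[].
Qed.

Lemma ae_sub (P Q : X -> Prop) : {ae mu, forall x, P x} ->
  (forall x, P x -> Q x) -> {ae mu, forall x, Q x}.
Proof. by move=> aeP PQ; apply: filterS aeP. Qed.

Lemma Rintegral_ae_eq f g : measurable_fun setT f -> measurable_fun setT g ->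
  {ae mu, forall x, f x = g x} -> \int[mu]_x f x = \int[mu]_x g x.
Proof.
move=> mf mg fg; congr fine; apply: ae_eq_integral => //.
- exact/measurable_EFinP.
- exact/measurable_EFinP.
- by apply: (ae_sub fg) => x fgx _ /=; rewrite fgx.
Qed.

Lemma ae_eq_integrable1 f g : measurable_fun setT f ->
  {ae mu, forall x, f x = g x} -> integrable1 g -> integrable1 f.
Proof.
move=> mf fg g1; apply/integrableP; split; first exact/measurable_EFinP.
have /integrableP[mg gfin] := g1.
rewrite (ae_eq_integral (fun x => `|(EFin \o g) x|)%E) //.
- by apply: measurableT_comp => //; exact/measurable_EFinP.
- exact: measurableT_comp.
- by apply: (ae_sub fg) => x fgx _ /=; rewrite fgx.
Qed.

Lemma ae_sub2 (P Q S : X -> Prop) : {ae mu, forall x, P x} ->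
  {ae mu, forall x, Q x} -> (forall x, P x -> Q x -> S x) ->
  {ae mu, forall x, S x}.
Proof. by move=> aeP aeQ PQS; apply: filterS2 aeP aeQ. Qed.

End real_integrals.

(** * Families continuous in time with values in L^1 and L^2 *)

Section L1_continuity.
Context d (X : measurableType d) (R : realType).
Variable mu : {finite_measure set X -> \bar R}.
Implicit Types (f g : R -> X -> R) (T : R).

Definition L1_continuous T f :=
  (forall t, 0 <= t <= T -> integrable1 mu (f t)) /\
  (forall s, 0 <= s <= T -> forall e, 0 < e -> exists2 r, 0 < r &
    forall t, 0 <= t <= T -> `|t - s| < r -> \int[mu]_x `|f t x - f s x| <= e).

Definition L2_continuous T f :=
  [/\ forall t, 0 <= t <= T -> measurable_fun setT (f t),
      forall t, 0 <= t <= T -> integrable1 mu (fun x => f t x ^+ 2) &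
      forall s, 0 <= s <= T -> forall e, 0 < e -> exists2 r, 0 < r &
        forall t, 0 <= t <= T -> `|t - s| < r ->
        \int[mu]_x (f t x - f s x) ^+ 2 <= e].

Lemma dist_within_continuous T (h : R -> R) :
  (forall s, 0 <= s <= T -> forall e, 0 < e -> exists2 r, 0 < r &
    forall t, 0 <= t <= T -> `|t - s| < r -> `|h t - h s| <= e) ->
  {within `[0, T], continuous h}.
Proof.
move=> H; apply/subspace_continuousP => s /= s0T.
apply/cvgrPdist_le => e e0.
have [r r0 Hr] := H s s0T e e0.
rewrite near_withinE; exists r => //= t st tT.
by rewrite distrC; apply: Hr; rewrite // distrC.
Qed.

Lemma L1_continuous_pairing T f (g : X -> R) C : L1_continuous T f ->
  measurable_fun setT g -> (forall x, `|g x| <= C) ->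
  forall s t, 0 <= s <= T -> 0 <= t <= T ->
  `|\int[mu]_x (f t x * g x) - \int[mu]_x (f s x * g x)| <=
  C * \int[mu]_x `|f t x - f s x|.
Proof.
move=> [f1 _] mg gC s t s0T t0T.
have ft := f1 _ t0T; have fs := f1 _ s0T.
have fts := integrable1B ft fs.
rewrite -RintegralB//; [|exact: integrable1_Mbounded ft mg gC
                        |exact: integrable1_Mbounded fs mg gC].
apply: (le_trans (le_normr_Rintegral _ _)) => //.
  exact: integrable1B (integrable1_Mbounded ft mg gC)
    (integrable1_Mbounded fs mg gC).
rewrite -RintegralZl//; last exact: integrable1_norm fts.
apply: le_Rintegral => //.
- apply: integrable1_norm.
  exact: integrable1B (integrable1_Mbounded ft mg gC)
    (integrable1_Mbounded fs mg gC).
- by apply: integrable1Z; exact: integrable1_norm fts.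
- by move=> x _; rewrite -mulrBl normrM mulrC ler_wpM2r.
Qed.

Lemma L1_continuous_within T f (g : X -> R) C : L1_continuous T f ->
  measurable_fun setT g -> (forall x, `|g x| <= C) ->
  {within `[0, T], continuous (fun t => \int[mu]_x (f t x * g x))}.
Proof.
move=> fc mg gC; apply: dist_within_continuous => s s0T e e0.
have C0 : 0 <= C by apply: le_trans (gC point).
have [|r r0 H] := fc.2 s s0T (e / (C + 1)).
  by rewrite divr_gt0// ltr_wpDl.
exists r => // t t0T ts.
apply: (le_trans (L1_continuous_pairing fc mg gC s0T t0T)).
apply: (le_trans (ler_wpM2l C0 (H t t0T ts))).
by rewrite mulrA ler_pdivrMr ?ltr_wpDl// mulrC ler_wpM2l ?(ltW e0)// lerDl.
Qed.

Lemma L1_continuous_norm T f : L1_continuous T f ->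
  {within `[0, T], continuous (fun t => \int[mu]_x `|f t x|)}.
Proof.
move=> fc; apply: dist_within_continuous => s s0T e e0.
have [r r0 H] := fc.2 s s0T e e0; exists r => // t t0T ts.
apply: le_trans (H t t0T ts).
have ft := fc.1 _ t0T; have fs := fc.1 _ s0T.
have nft := integrable1_norm ft; have nfs := integrable1_norm fs.
rewrite -RintegralB//.
apply: (le_trans (le_normr_Rintegral _ _)) => //; first exact: integrable1B.
apply: le_Rintegral => //.
- by apply: integrable1_norm; exact: integrable1B.
- by apply: integrable1_norm; exact: integrable1B.
- by move=> x _; exact: ler_dist_dist.
Qed.

Lemma L1_continuousD T f g : L1_continuous T f -> L1_continuous T g ->
  L1_continuous T (fun t x => f t x + g t x).
Proof.
move=> [f1 fc] [g1 gc]; split=> [t t0T|s s0T e e0].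
  by apply: integrable1D; [exact: f1|exact: g1].
have e20 : 0 < e / 2 by rewrite divr_gt0.
have [r r0 H] := fc s s0T _ e20; have [q q0 K] := gc s s0T _ e20.
exists (Num.min r q) => [|t t0T]; first by rewrite lt_min r0.
rewrite lt_min => /andP[tr tq].
rewrite [leRHS]splitr; apply: le_trans (lerD (H t t0T tr) (K t t0T tq)).
have fts := integrable1B (f1 t t0T) (f1 s s0T).
have gts := integrable1B (g1 t t0T) (g1 s s0T).
have nfts := integrable1_norm fts; have ngts := integrable1_norm gts.
rewrite -RintegralD//; apply: le_Rintegral => //.
- apply: integrable1_norm; apply: integrable1B; apply: integrable1D;
  by [exact: f1|exact: g1].
- exact: integrable1D.
- by move=> x _; rewrite opprD addrACA ler_normD.
Qed.

Lemma within_continuous_dist T (h : R -> R) : {within `[0, T], continuous h} ->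
  forall s, 0 <= s <= T -> forall e, 0 < e -> exists2 r, 0 < r &
    forall t, 0 <= t <= T -> `|t - s| < r -> `|h t - h s| <= e.
Proof.
move=> /subspace_continuousP hc s s0T e e0.
have := hc s s0T; move=> /cvgrPdist_le /(_ e e0).
rewrite near_withinE => -[r /= r0 H].
exists r => // t t0T ts.
by rewrite distrC; apply: H; rewrite //= distrC.
Qed.

Lemma L1_continuousM T (c : R -> R) f : {within `[0, T], continuous c} ->
  L1_continuous T f -> L1_continuous T (fun t x => c t * f t x).
Proof.
move=> cc [f1 fc]; split=> [t t0T|s s0T e e0].
  by apply: integrable1Z; exact: f1.
set N := \int[mu]_x `|f s x|.
have N0 : 0 <= N by exact: Rintegral_ge0.
have [|r r0 H] := within_continuous_dist cc s0T (e := Num.min 1 (e / 2 / (N + 1))).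
  by rewrite lt_min ltr01 !divr_gt0// ltr_wpDl.
have [|q q0 K] := fc s s0T (e / 2 / (`|c s| + 1)).
  by rewrite !divr_gt0// ltr_wpDl.
exists (Num.min r q) => [|t t0T]; first by rewrite lt_min r0.
rewrite lt_min => /andP[tr tq].
have := H t t0T tr; rewrite le_min => /andP[ct1 ct2].
have fts := integrable1_norm (integrable1B (f1 t t0T) (f1 s s0T)).
have nfs := integrable1_norm (f1 s s0T).
apply: (@le_trans _ _ (\int[mu]_x ((`|c s| + 1) * `|f t x - f s x| +
    `|c t - c s| * `|f s x|))).
  apply: le_Rintegral => //.
  - apply: integrable1_norm; apply: integrable1B; apply: integrable1Z; exact: f1.
  - by apply: integrable1D; exact: integrable1Z.
  - move=> x _; have -> : c t * f t x - c s * f s x =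
        c t * (f t x - f s x) + (c t - c s) * f s x by ring.
    apply: (le_trans (ler_normD _ _)); rewrite !normrM lerD// ler_wpM2r//.
    by rewrite -[c t](subrK (c s)) addrC (le_trans (ler_normD _ _))// lerD2l.
rewrite RintegralD//; [|exact: integrable1Z|exact: integrable1Z].
rewrite !RintegralZl// -/N [leRHS]splitr lerD//.
  by rewrite mulrC -ler_pdivlMr ?ltr_wpDl//; exact: K.
apply: (le_trans (ler_wpM2r N0 ct2)).
rewrite -(mulrA (e / 2)); apply: ler_piMr; first by rewrite divr_ge0 ?(ltW e0).
by rewrite mulrC ler_pdivrMr ?ltr_wpDl// mul1r lerDl.
Qed.

Lemma L1_continuousZ T c f : L1_continuous T f ->
  L1_continuous T (fun t x => c * f t x).
Proof.
by apply: L1_continuousM; move=> ?; exact: cvg_cst.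
Qed.

Lemma mulr_young (h x y : R) : 0 < h ->
  `|x * y| <= 2^-1 * (h * x ^+ 2 + h^-1 * y ^+ 2).
Proof.
move=> h0; rewrite normrM -(real_normK (num_real x)) -(real_normK (num_real y)).
move: (normr_ge0 x) (normr_ge0 y); move: `|x| `|y| => a b a0 b0.
have : 0 <= h^-1 * (h * a - b) ^+ 2 by rewrite mulr_ge0 ?sqr_ge0// invr_ge0 ltW.
have -> : h^-1 * (h * a - b) ^+ 2 = h * a ^+ 2 + h^-1 * b ^+ 2 - 2 * (a * b).
  by field; rewrite gt_eqF.
lra.
Qed.

Lemma integrable1_sqr_mul (f g : X -> R) : measurable_fun setT f ->
  measurable_fun setT g -> integrable1 mu (fun x => f x ^+ 2) ->
  integrable1 mu (fun x => g x ^+ 2) -> integrable1 mu (fun x => f x * g x).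
Proof.
move=> mf mg f2 g2.
apply: (le_integrable1 (g := fun x => 2^-1 * (f x ^+ 2 + g x ^+ 2))).
- exact: measurable_funM.
- by move=> x; have := mulr_young (f x) (g x) ltr01; rewrite invr1 !mul1r.
- by apply: integrable1Z; exact: integrable1D.
Qed.

Lemma integrable1_sqrB (f g : X -> R) : measurable_fun setT f ->
  measurable_fun setT g -> integrable1 mu (fun x => f x ^+ 2) ->
  integrable1 mu (fun x => g x ^+ 2) ->
  integrable1 mu (fun x => (f x - g x) ^+ 2).
Proof.
move=> mf mg f2 g2.
apply: (le_integrable1 (g := fun x => 2 * (f x ^+ 2 + g x ^+ 2))).
- by apply: measurable_funX; exact: measurable_funB.
- move=> x; rewrite ger0_norm ?sqr_ge0//.
  have := sqr_ge0 (f x + g x); nra.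
- by apply: integrable1Z; exact: integrable1D.
Qed.

(** Cauchy-Schwarz, in the weighted form that avoids square roots of
    integrals. *)
Lemma L2_continuous_mul T f g : L2_continuous T f -> L2_continuous T g ->
  L1_continuous T (fun t x => f t x * g t x).
Proof.
move=> [mf f2 fc] [mg g2 gc]; split=> [t t0T|s s0T e e0].
  by apply: integrable1_sqr_mul; [exact: mf|exact: mg|exact: f2|exact: g2].
set A := \int[mu]_x (f s x ^+ 2); set B := \int[mu]_x (g s x ^+ 2).
have A0 : 0 <= A by apply: Rintegral_ge0 => x _; exact: sqr_ge0.
have B0 : 0 <= B by apply: Rintegral_ge0 => x _; exact: sqr_ge0.
(* The weight [h] absorbs the norms at time [s], then [q] is small compared to
   [h]. *)
pose h := e / (A + B + 1).
have AB1 : 0 < A + B + 1 by rewrite ltr_wpDl// addr_ge0.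
have h0 : 0 < h by rewrite divr_gt0.
have h1 : 0 < 1 + h^-1 by rewrite addr_gt0// invr_gt0.
pose q := e / 2 / (1 + h^-1).
have q0 : 0 < q by rewrite !divr_gt0.
have [r r0 H] := fc s s0T q q0; have [r' r'0 K] := gc s s0T q q0.
exists (Num.min r r') => [|t t0T]; first by rewrite lt_min r0.
rewrite lt_min => /andP[/(H _ t0T) fts /(K _ t0T) gts].
have fts1 := integrable1_sqrB (mf _ t0T) (mf _ s0T) (f2 _ t0T) (f2 _ s0T).
have gts1 := integrable1_sqrB (mg _ t0T) (mg _ s0T) (g2 _ t0T) (g2 _ s0T).
have fs1 := f2 _ s0T; have gs1 := g2 _ s0T.
(* Three applications of [mulr_young]: to the product of the two increments with
   weight 1, and to each product with a value at time [s] with weight [h]. *)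
pose W x := (2^-1 * (1 + h^-1)) * ((f t x - f s x) ^+ 2 + (g t x - g s x) ^+ 2)
  + (2^-1 * h) * (f s x ^+ 2 + g s x ^+ 2).
apply: (@le_trans _ _ (\int[mu]_x W x)).
  apply: le_Rintegral => //.
  - apply: integrable1_norm; apply: integrable1B; apply: integrable1_sqr_mul;
      by [exact: mf|exact: mg|exact: f2|exact: g2].
  - by apply: integrable1D; apply: integrable1Z; exact: integrable1D.
  - move=> x _; have -> : f t x * g t x - f s x * g s x =
        (f t x - f s x) * (g t x - g s x) + f s x * (g t x - g s x)
        + g s x * (f t x - f s x) by ring.
    apply: (le_trans (ler_normD _ _)).
    apply: (le_trans (lerD (ler_normD _ _) (lexx _))).
    have Y1 := mulr_young (f t x - f s x) (g t x - g s x) ltr01.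
    have Y2 := mulr_young (f s x) (g t x - g s x) h0.
    have Y3 := mulr_young (g s x) (f t x - f s x) h0.
    apply: (le_trans (lerD (lerD Y1 Y2) Y3)); rewrite /W invr1 !mul1r.
    by rewrite le_eqVlt; apply/orP; left; apply/eqP; ring.
rewrite RintegralD//; try by apply: integrable1Z; exact: integrable1D.
rewrite !RintegralZl//; try exact: integrable1D.
rewrite !RintegralD// -/A -/B.
set F := \int[mu]_x _ in fts *; set G := \int[mu]_x _ in gts *.
have -> : e = (2^-1 * (1 + h^-1)) * (q + q) + 2^-1 * e.
  by rewrite /q; field; rewrite !gt_eqF// addrC -[X in X + _]divr1 ?addr_gt0.
apply: lerD; first by rewrite ler_wpM2l ?lerD// mulr_ge0// ltW.
rewrite -mulrA ler_wpM2l// /h -mulrA; apply: ler_piMr; first exact: ltW.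
by rewrite mulrC ler_pdivrMr// mul1r lerDl.
Qed.

Lemma L2_continuous_cst T (c : R) : L2_continuous T (fun _ _ => c).
Proof.
split=> [t _|t _|s _ e e0].
- exact: measurable_cst.
- by have := finite_measure_integrable_cst mu (c ^+ 2) (@measurableT _ X).
- exists 1 => // t _ _.
  by rewrite (_ : (fun x => _) = cst 0) ?Rintegral_cst ?mul0r ?(ltW e0)//;
    apply/funext => x; rewrite subrr expr0n.
Qed.

Lemma L2_continuous_L1 T f : L2_continuous T f -> L1_continuous T f.
Proof.
move=> fc; have [f1 H] := L2_continuous_mul fc (L2_continuous_cst T 1).
split=> [t /f1|s /H{}H e /H[r r0 {}H]].
  by under eq_fun do rewrite mulr1.
exists r => // t t0T ts; apply: le_trans (H t t0T ts).
by under eq_Rintegral do rewrite -[f t _]mulr1 -[f s _]mulr1.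
Qed.

(** Nonlinear functions of [L^2]-continuous families are [L^2]-continuous when
    they are pointwise Lipschitz. *)
Lemma L2_continuous_lipschitz T (f1 f2 g : R -> X -> R) (C : R) :
  L2_continuous T f1 -> L2_continuous T f2 ->
  (forall t, 0 <= t <= T -> measurable_fun setT (g t)) ->
  (forall t, 0 <= t <= T -> integrable1 mu (fun x => g t x ^+ 2)) ->
  (forall s t x, (g t x - g s x) ^+ 2 <=
    C * ((f1 t x - f1 s x) ^+ 2 + (f2 t x - f2 s x) ^+ 2)) ->
  0 <= C -> L2_continuous T g.
Proof.
move=> [mf1 sf1 cf1] [mf2 sf2 cf2] mg sg gf C0; split=> // s sT e e0.
have C1 : 0 < C + 1 by rewrite ltr_wpDl.
have q0 : 0 < e / 2 / (C + 1) by rewrite !divr_gt0.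
have [r1 r10 H1] := cf1 s sT _ q0; have [r2 r20 H2] := cf2 s sT _ q0.
exists (Num.min r1 r2) => [|t tT]; first by rewrite lt_min r10.
rewrite lt_min => /andP[/(H1 _ tT) f1ts /(H2 _ tT) f2ts].
have i1 := integrable1_sqrB (mf1 _ tT) (mf1 _ sT) (sf1 _ tT) (sf1 _ sT).
have i2 := integrable1_sqrB (mf2 _ tT) (mf2 _ sT) (sf2 _ tT) (sf2 _ sT).
have ig := integrable1_sqrB (mg _ tT) (mg _ sT) (sg _ tT) (sg _ sT).
apply: (@le_trans _ _ (\int[mu]_x
    (C * ((f1 t x - f1 s x) ^+ 2 + (f2 t x - f2 s x) ^+ 2)))).
  by apply: le_Rintegral => //; apply: integrable1Z; exact: integrable1D.
rewrite RintegralZl//; last exact: integrable1D.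
rewrite RintegralD//; apply: (le_trans (ler_wpM2l C0 (lerD f1ts f2ts))).
rewrite -mulrDl -splitr mulrA ler_pdivrMr// mulrC ler_wpM2l ?(ltW e0)//.
by rewrite lerDl.
Qed.

Lemma L2_continuousD T f g : L2_continuous T f -> L2_continuous T g ->
  L2_continuous T (fun t x => f t x + g t x).
Proof.
move=> fc gc; have [mf f2 _] := fc; have [mg g2 _] := gc.
have mfg t : 0 <= t <= T -> measurable_fun setT (fun x => f t x + g t x).
  by move=> tT; apply: measurable_funD; [exact: mf|exact: mg].
apply: (L2_continuous_lipschitz (C := 2) fc gc) => // [t tT|s t x].
- apply: (le_integrable1 (g := fun x => 2 * (f t x ^+ 2 + g t x ^+ 2))).
  + by apply: measurable_funX; exact: mfg.
  + move=> x; rewrite ger0_norm ?sqr_ge0//.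
    by have := sqr_ge0 (f t x - g t x); nra.
  + by apply: integrable1Z; apply: integrable1D; [exact: f2|exact: g2].
- have := sqr_ge0 ((f t x - f s x) - (g t x - g s x)); nra.
Qed.

Lemma L2_continuousZ T c f : L2_continuous T f ->
  L2_continuous T (fun t x => c * f t x).
Proof.
move=> fc; have [mf f2 _] := fc.
have mcf t : 0 <= t <= T -> measurable_fun setT (fun x => c * f t x).
  by move=> tT; apply: measurable_funM => //; exact: mf.
apply: (L2_continuous_lipschitz (C := c ^+ 2) fc fc) => // [t tT|s t x|].
- apply: (le_integrable1 (g := fun x => c ^+ 2 * f t x ^+ 2)).
  + by apply: measurable_funX; exact: mcf.
  + by move=> x; rewrite exprMn ger0_norm// mulr_ge0 ?sqr_ge0.
  + by apply: integrable1Z; exact: f2.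
- rewrite -mulrBr exprMn ler_wpM2l ?sqr_ge0//.
  by rewrite lerDl sqr_ge0.
- exact: sqr_ge0.
Qed.

(** The reverse triangle inequality, by Cauchy-Schwarz in the plane. *)
Lemma hypot_lipschitz (a b a' b' : R) :
  (Num.sqrt (a ^+ 2 + b ^+ 2) - Num.sqrt (a' ^+ 2 + b' ^+ 2)) ^+ 2 <=
  (a - a') ^+ 2 + (b - b') ^+ 2.
Proof.
have h2 : 0 <= a ^+ 2 + b ^+ 2 by rewrite addr_ge0 ?sqr_ge0.
have h'2 : 0 <= a' ^+ 2 + b' ^+ 2 by rewrite addr_ge0 ?sqr_ge0.
have := sqr_sqrtr h2; have := sqr_sqrtr h'2.
have := sqrtr_ge0 (a ^+ 2 + b ^+ 2); have := sqrtr_ge0 (a' ^+ 2 + b' ^+ 2).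
move: (Num.sqrt _) (Num.sqrt _) => h' h h'0 h0 hE' hE.
suff : a * a' + b * b' <= h * h' by clear -hE hE'; nra.
rewrite leNgt; apply/negP => lt; have hh' : 0 <= h * h' by rewrite mulr_ge0.
have : (h * h') ^+ 2 < (a * a' + b * b') ^+ 2.
  by rewrite ltr_pXn2r ?nnegrE//; apply: le_trans (ltW lt).
rewrite exprMn hE hE'; have := sqr_ge0 (a * b' - b * a').
by clear; nra.
Qed.

Lemma L2_continuous_hypot T f g : L2_continuous T f -> L2_continuous T g ->
  L2_continuous T (fun t x => Num.sqrt (f t x ^+ 2 + g t x ^+ 2)).
Proof.
move=> fc gc; have [mf f2 _] := fc; have [mg g2 _] := gc.
apply: (L2_continuous_lipschitz (C := 1) fc gc) => // [t tT|t tT|s t x].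
- apply: (measurableT_comp (f := @Num.sqrt R)).
    by apply: continuous_measurable_fun; exact: sqrt_continuous.
  by apply: measurable_funD; apply: measurable_funX; [exact: mf|exact: mg].
- have := integrable1D (f2 _ tT) (g2 _ tT).
  apply: eq_integrable => // x _ /=.
  by rewrite sqr_sqrtr// addr_ge0 ?sqr_ge0.
- by rewrite mul1r hypot_lipschitz.
Qed.

End L1_continuity.

(** * Density of the test functions *)

Section torus_density.
Variable R : realType.
Local Notation X := (measurableTypeR R * measurableTypeR R)%type.
Local Notation mu := (@torus_measure R).
Local Notation leb := (@lebesgue_measure R).

Lemma ae_torus_fundamental :
  {ae mu, forall x : X, (0 <= x.1 < 1) /\ (0 <= x.2 < 1)}.
Proof.
have mC : measurable (~` @circle R) by apply: measurableC; exact: measurable_circle.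
have C0 : circle_measure (~` @circle R) = 0%E.
  by rewrite /circle_measure /mfrestr /mrestr setICl measure0.
have muX A B : measurable A -> measurable B ->
    mu (A `*` B) = (circle_measure A * circle_measure B)%E.
  exact: (product_measure1E (@circle_measure R) (@circle_measure R)).
have m1 : @measurable _ X ((~` @circle R) `*` setT) by exact: measurableX.
have m2 : @measurable _ X (setT `*` (~` @circle R)) by exact: measurableX.
exists ((~` @circle R) `*` setT `|` setT `*` (~` @circle R)); split.
- exact: measurableU.
- apply/eqP; rewrite -measure_le0.
  apply: (le_trans (measureU2 mu m1 m2)).
  by rewrite [X in (X + _)%E]muX// [X in (_ + X)%E]muX// C0 mule0 mul0e adde0.
- move=> [x1 x2] /= H.
  have [x1C|x1C] := pselect (circle x1); last by left.
  right; split=> // x2C; apply: H.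
  by move: x1C x2C; rewrite /circle /= !in_itv.
Qed.

(** Cylinders over rays: a generating class of the product Borel sets that is
    stable by intersection and whose members are limits of test functions. *)
Definition ray_or_line : set (set (measurableTypeR R)) :=
  [set A | A = setT \/ exists a, A = `]a, +oo[%classic].

Definition ray_cylinders : set (set X) :=
  [set A `*` B | A in ray_or_line & B in ray_or_line].

Lemma ray_or_line_measurable A : ray_or_line A -> measurable A.
Proof. by move=> [->//|[a ->]]; exact: measurable_itv. Qed.

Lemma ray_or_lineI : setI_closed ray_or_line.
Proof.
move=> A B [->|[a ->]] [->|[b ->]].
- by left; rewrite setIT.
- by right; exists b; rewrite setTI.
- by right; exists a; rewrite setIT.
- right; exists (Num.max a b); apply/seteqP; split=> x /=.
    by rewrite !in_itv/= !andbT gt_max => -[-> ->].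
  by rewrite !in_itv/= !andbT gt_max => /andP[].
Qed.

Lemma ray_cylindersI : setI_closed ray_cylinders.
Proof.
move=> _ _ [A cA [B cB <-]] [A' cA' [B' cB' <-]].
exists (A `&` A'); first exact: ray_or_lineI.
exists (B `&` B'); first exact: ray_or_lineI.
by rewrite setXI.
Qed.

Lemma measurable_ray_cylinders :
  @measurable _ X = <<s ray_cylinders >>.
Proof.
have lineT : ray_or_line setT by left.
have rayP a : ray_or_line `]a, +oo[%classic by right; exists a.
apply/seteqP; split; last first.
  apply: smallest_sub; first exact: sigma_algebra_measurable.
  by move=> _ [A cA [B cB <-]]; apply: measurableX; exact: ray_or_line_measurable.
apply: smallest_sub; first exact: smallest_sigma_algebra.
pose Y := g_sigma_algebraType ray_cylinders.
have m1 : measurable_fun (setT : set Y) (fst : Y -> measurableTypeR R).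
  apply: (measurability _ (RGenOInfty.measurableE R)).
  move=> _ [_ [a ->] <-]; apply: sub_sigma_algebra.
  exists `]a, +oo[%classic => //; exists setT => //.
  by rewrite setTI; apply/seteqP; split=> x //= [].
have m2 : measurable_fun (setT : set Y) (snd : Y -> measurableTypeR R).
  apply: (measurability _ (RGenOInfty.measurableE R)).
  move=> _ [_ [a ->] <-]; apply: sub_sigma_algebra.
  by exists setT => //; exists `]a, +oo[%classic.
move=> A [] [B mB <-]; first exact: m1.
exact: m2.
Qed.

Lemma ray_or_line_approximation A : ray_or_line A ->
  exists p : nat -> R -> R,
  [/\ forall n, smooth_line (p n), forall n x, p n (x + 1) = p n x,
      forall n x, 0 <= p n x <= 1 &
      forall x : R, 0 <= x < 1 -> p n x @[n --> \oo] --> (\1_A x : R) ].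
Proof.
move=> [->|[a ->]].
  exists (fun _ => cst 1); split=> // [n|n x|x _]; first exact: smooth_line_cst.
    by rewrite /= ler01 lexx.
  by rewrite indicT; exact: cvg_cst.
have [p [sp pp p01 pa]] := ray_approximation a.
exists p; split=> // x x01.
by rewrite indicE mem_setE in_itv/= andbT; exact: pa.
Qed.

(** The functional [test_against] is given by a family that depends on time, so
    that a single density argument serves both the spatial weak derivatives (a
    constant family) and the evolution equation (a family weighted by a test
    function of time).  It extends from test functions to bounded ones by
    dominated convergence, in space and then in time. *)
Section vanishing_functional.
Import HBSimple HBNNSimple.
Variables (T : R) (L : R -> X -> R).
Hypothesis Lc : L1_continuous mu T L.

Definition test_against (g : X -> R) : R :=
  \int[leb]_(t in `]0, T[) \int[mu]_x (L t x * g x).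

Lemma itv_cc_oo (t : R) : `]0, T[%classic t -> 0 <= t <= T.
Proof. by rewrite /= in_itv/= => /andP[/ltW -> /ltW ->]. Qed.

Lemma within_integrable (h : R -> R) : {within `[0, T], continuous h} ->
  leb.-integrable `]0, T[ (EFin \o h).
Proof.
move=> hc; apply: (@integrableS _ (measurableTypeR R) R leb `[0, T]%classic) => //.
  by move=> t /itv_cc_oo; rewrite /= in_itv.
by apply: continuous_compact_integrable => //; exact: segment_compact.
Qed.

Lemma test_against_cvg (G : nat -> X -> R) (g : X -> R) (C : R) :
  (forall n, measurable_fun setT (G n)) -> (forall n x, `|G n x| <= C) ->
  measurable_fun setT g -> (forall x, `|g x| <= C) ->
  {ae mu, forall x, G n x @[n --> \oo] --> g x} ->
  test_against (G n) @[n --> \oo] --> test_against g.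
Proof.
move=> mG GC mg gC Gg.
have C0 : 0 <= C by apply: le_trans (gC point).
have mLg (h : X -> R) : measurable_fun setT h -> (forall x, `|h x| <= C) ->
    measurable_fun `]0, T[ (fun t => \int[mu]_x (L t x * h x)).
  move=> mh hC.
  have := within_integrable (L1_continuous_within Lc mh hC).
  by move=> /measurable_int/measurable_EFinP.
apply: (@Rintegral_dominated_cvg _ (measurableTypeR R) R leb `]0, T[%classic
  (fun n t => \int[mu]_x (L t x * G n x)) (fun t => \int[mu]_x (L t x * g x))
  (fun t => C * \int[mu]_x `|L t x|)).
- exact: measurable_itv.
- by move=> n; exact: mLg.
- exact: mLg.
- apply: aeW => t t0T; have tT := itv_cc_oo t0T.
  have L1 := Lc.1 _ tT.
  apply: (@Rintegral_dominated_cvg _ _ R mu setT (fun n x => L t x * G n x)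
    (fun x => L t x * g x) (fun x => C * `|L t x|)) => //.
  + by move=> n; apply: measurable_funM => //; exact: integrable1_measurable L1.
  + by apply: measurable_funM => //; exact: integrable1_measurable L1.
  + by apply: filterS Gg => x Gx _; apply: cvgM => //; exact: cvg_cst.
  + by apply: integrable1Z; exact: integrable1_norm.
  + by apply: aeW => x n _; rewrite normrM mulrC ler_wpM2r.
- have I := within_integrable (L1_continuous_norm Lc).
  have mI : @measurable _ (measurableTypeR R) `]0, T[%classic by [].
  have := integrableZl mI C I.
  by apply: eq_integrable => // t _.
- apply: aeW => t n t0T; have tT := itv_cc_oo t0T.
  have L1 := Lc.1 _ tT.
  apply: (le_trans (le_normr_Rintegral _ _)) => //.
    exact: integrable1_Mbounded L1 (mG n) (GC n).
  rewrite -RintegralZl//; last exact: integrable1_norm.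
  apply: le_Rintegral => //.
  + by apply: integrable1_norm; exact: integrable1_Mbounded L1 (mG n) (GC n).
  + by apply: integrable1Z; exact: integrable1_norm.
  + by move=> x _; rewrite normrM mulrC ler_wpM2r.
Qed.

Definition bounded_measurable (g : X -> R) :=
  measurable_fun setT g /\ exists C, forall x, `|g x| <= C.

Lemma bounded_measurableD (g h : X -> R) :
  bounded_measurable g -> bounded_measurable h ->
  bounded_measurable (fun x => g x + h x).
Proof.
move=> [mg [C gC]] [mh [D hD]]; split; first exact: measurable_funD.
by exists (C + D) => x; rewrite (le_trans (ler_normD _ _))// lerD.
Qed.

Lemma bounded_measurableZ (c : R) (g : X -> R) : bounded_measurable g ->
  bounded_measurable (fun x => c * g x).
Proof.
move=> [mg [C gC]]; split; first exact: measurable_funM.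
by exists (`|c| * C) => x; rewrite normrM ler_wpM2l.
Qed.

Lemma bounded_measurable_indic (A : set X) : measurable A -> bounded_measurable \1_A.
Proof.
move=> mA; split; first exact: measurable_indic.
by exists 1 => x; rewrite indicE; case: (_ \in _); rewrite ?normr1 ?normr0.
Qed.

Lemma test_against_linear (c : R) (g h : X -> R) :
  bounded_measurable g -> bounded_measurable h ->
  test_against (fun x => c * g x + h x) = c * test_against g + test_against h.
Proof.
move=> [mg [C gC]] [mh [D hD]].
have ig := within_integrable (L1_continuous_within Lc mg gC).
have ih := within_integrable (L1_continuous_within Lc mh hD).
rewrite /test_against -RintegralZl// -RintegralD//; last first.
  by apply: integrableZl ig.
apply: eq_Rintegral => t; rewrite inE => /itv_cc_oo tT; have L1 := Lc.1 _ tT.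
rewrite -RintegralZl//; last exact: integrable1_Mbounded L1 mg gC.
rewrite -RintegralD//; last 2 first.
  by apply: integrable1Z; exact: integrable1_Mbounded L1 mg gC.
  exact: integrable1_Mbounded L1 mh hD.
by apply: eq_Rintegral => x _; ring.
Qed.

Lemma test_against_eq0_sum (I : Type) (s : seq I) (c : I -> R)
    (A : I -> set X) : (forall i, measurable (A i)) ->
  (forall i, test_against \1_(A i) = 0) ->
  test_against (fun x => \sum_(i <- s) c i * \1_(A i) x) = 0.
Proof.
move=> mA A0.
suff : bounded_measurable (fun x => \sum_(i <- s) c i * \1_(A i) x) /\
    test_against (fun x => \sum_(i <- s) c i * \1_(A i) x) = 0 by case.
elim: s => [|i s [IHm IH]].
  rewrite (_ : (fun x => _) = cst 0); last first.
    by apply/funext => x; rewrite big_nil.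
  split; first by split; [exact: measurable_cst|exists 0 => x; rewrite normr0].
  rewrite /test_against.
  under eq_Rintegral => t _.
    under eq_Rintegral do rewrite mulr0.
    rewrite Rintegral_cst// mul0r; over.
  by rewrite Rintegral_cst// mul0r.
have mi := bounded_measurable_indic (mA i).
rewrite (_ : (fun x => _) =
    (fun x => c i * \1_(A i) x + \sum_(i <- s) c i * \1_(A i) x)); last first.
  by apply/funext => x; rewrite big_cons.
split; first exact: bounded_measurableD (bounded_measurableZ _ mi) IHm.
by rewrite test_against_linear// IH A0 mulr0 addr0.
Qed.

Hypothesis L0 : forall p q, smooth_line p -> smooth_line q ->
  (forall x, p (x + 1) = p x) -> (forall x, q (x + 1) = q x) ->
  test_against (tensor p q) = 0.

Lemma test_against_eq0_cvg (G : nat -> X -> R) (g : X -> R) (C : R) :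
  (forall n, measurable_fun setT (G n)) -> (forall n x, `|G n x| <= C) ->
  measurable_fun setT g -> (forall x, `|g x| <= C) ->
  {ae mu, forall x, G n x @[n --> \oo] --> g x} ->
  (forall n, test_against (G n) = 0) -> test_against g = 0.
Proof.
move=> mG GC mg gC Gg G0.
have := test_against_cvg mG GC mg gC Gg.
under eq_fun do rewrite G0.
by move=> H; apply: (cvg_unique _ H); [exact: norm_hausdorff|exact: cvg_cst].
Qed.

Lemma test_against_cylinder (A : set X) : ray_cylinders A -> test_against \1_A = 0.
Proof.
move=> [A1 c1 [A2 c2 <-]].
have [p [sp pp p01 pA]] := ray_or_line_approximation c1.
have [q [sq qp q01 qA]] := ray_or_line_approximation c2.
have mA : @measurable _ X (A1 `*` A2).
  by apply: measurableX; exact: ray_or_line_measurable.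
have mline (h : R -> R) : smooth_line h ->
    measurable_fun setT (h : measurableTypeR R -> R).
  by move=> sh; apply: continuous_measurable_fun; exact: smooth_line_continuous.
apply: (@test_against_eq0_cvg (fun n => tensor (p n) (q n)) _ 1).
- move=> n; apply: measurable_funM.
    by apply: (measurableT_comp (mline _ (sp n))); exact: measurable_fst.
  by apply: (measurableT_comp (mline _ (sq n))); exact: measurable_snd.
- move=> n [x1 x2]; rewrite /tensor /= normrM.
  have /andP[a0 a1] := p01 n x1; have /andP[b0 b1] := q01 n x2.
  by rewrite !ger0_norm// mulr_ile1.
- exact: measurable_indic.
- by move=> x; rewrite indicE; case: (_ \in _); rewrite ?normr1 ?normr0.
- apply: filterS ae_torus_fundamental => -[x1 x2] /= [x1C x2C].
  have -> : \1_(A1 `*` A2) (x1, x2) = \1_A1 x1 * \1_A2 x2 :> R.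
    by rewrite !indicE in_setX /=; do 2 case: (_ \in _); rewrite ?mulr1 ?mulr0.
  by apply: cvgM; [exact: pA|exact: qA].
- by move=> n; exact: L0.
Qed.

(** The sets whose indicators are annihilated form a Dynkin system. *)
Lemma test_against_indic (A : set X) : measurable A -> test_against \1_A = 0.
Proof.
move=> mA; rewrite measurable_ray_cylinders in mA.
have N1 : test_against \1_setT = 0.
  apply: test_against_cylinder; exists setT; first by left.
  by exists setT; [left|exact: setXTT].
have bi := bounded_measurable_indic.
have bT : bounded_measurable \1_(setT : set X) by exact: bi.
apply: (dynkin_induction (P := fun A => test_against \1_A = 0)
  measurable_ray_cylinders ray_cylindersI N1 _ _ _ mA).
- exact: test_against_cylinder.
- move=> S mS S0.
  have -> : \1_(~` S) = (fun x => -1 * \1_S x + \1_setT x) :> (X -> R).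
    apply/funext => x; rewrite !indicE in_setC in_setT.
    by case: (_ \in _) => /=; ring.
  by rewrite test_against_linear ?S0 ?N1 ?mulr0 ?addr0//; exact: bi.
move=> F mF tF F0.
pose U n := \big[setU/set0]_(k < n) F k.
have mU n : measurable (U n) by apply: bigsetU_measurable.
apply: (@test_against_eq0_cvg (fun n => \1_(U n)) _ 1).
- by move=> n; exact: measurable_indic.
- by move=> n x; rewrite indicE; case: (_ \in _); rewrite ?normr1 ?normr0.
- by apply: measurable_indic; exact: bigcup_measurable.
- by move=> x; rewrite indicE; case: (_ \in _); rewrite ?normr1 ?normr0.
- apply: aeW => x; rewrite [X in _ --> X]indicE.
  have [[k _ Fkx]|nFx] := pselect ((\bigcup_k F k) x); last first.
    rewrite memNset//; apply: cvg_near_cst; apply: nearW => n.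
    rewrite indicE memNset// /U -bigcup_mkord => -[k _ Fkx].
    by apply: nFx; exists k.
  rewrite mem_set; last by exists k.
  apply: cvg_near_cst; near=> n; rewrite indicE mem_set//.
  rewrite /U -bigcup_mkord; exists k => //=.
  by near: n; exact: nbhs_infty_gt.
elim=> [|n IH].
  rewrite /U big_ord0; have := test_against_linear (-1) bT bT.
  rewrite N1 mulr0 addr0 => <-; congr test_against.
  by apply/funext => x; rewrite !indicE in_set0 in_setT /=; ring.
have := test_against_linear 1 (bi _ (mU n)) (bi _ (mF n)).
rewrite IH F0 mulr0 addr0 => <-; congr test_against.
apply/funext => x; rewrite /U big_ord_recr /= !indicE in_setU mul1r.
have [xU|] := boolP (x \in \big[setU/set0]_(i < n) F i); last first.
  by move=> _; rewrite add0r.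
rewrite memNset ?addr0//= => Fnx.
move: xU; rewrite inE -bigcup_mkord => -[k /= kn Fkx].
have kE := tF k n I I (ex_intro _ x (conj Fkx Fnx)).
by rewrite kE ltnn in kn.
Unshelve. all: by end_near. Qed.

(** Simple functions reduce bounded functions to indicators; adding the bound
    first makes the function nonnegative. *)
Lemma test_against_eq0 (g : X -> R) : bounded_measurable g -> test_against g = 0.
Proof.
move=> [mg [C gC]].
have bi := bounded_measurable_indic.
have bT : bounded_measurable \1_setT by exact: bi.
have NT : test_against \1_setT = 0 by exact: test_against_indic.
have bg : bounded_measurable g by split=> //; exists C.
pose f x := g x + C.
have f0 x : 0 <= f x.
  by rewrite /f -lerBlDr sub0r; have := gC x; rewrite ler_norml => /andP[].
have f2C x : f x <= 2 * C.
  by rewrite /f mulr_natl mulr2n lerD2r (le_trans (ler_norm _)).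
have mf : measurable_fun setT f by exact: measurable_funD.
suff Nf : test_against f = 0.
  have bf : bounded_measurable f.
    by split=> //; exists (2 * C) => x; rewrite ger0_norm.
  have := test_against_linear (- C) bT bf.
  rewrite Nf NT mulr0 addr0 => <-; congr test_against.
  by apply/funext => x; rewrite indicT /= /f; ring.
have mfE : measurable_fun setT (EFin \o f) by exact/measurable_EFinP.
have f0E x : setT x -> (0 <= (EFin \o f) x)%E by rewrite /= lee_fin.
pose s n := nnsfun_approx measurableT mfE n.
have sf n x : s n x <= f x.
  by rewrite -lee_fin /s nnsfun_approxE; exact: le_approx.
apply: (@test_against_eq0_cvg (fun n => s n) _ (2 * C)).
- by move=> n; exact: measurable_funPT.
- by move=> n x; rewrite ger0_norm// (le_trans (sf n x)).
- exact: mf.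
- by move=> x; rewrite ger0_norm.
- apply: aeW => x.
  have := cvg_nnsfun_approx measurableT mfE f0E (x := x) I.
  by move=> /fine_cvg.
move=> n.
have -> : s n = (fun x => \sum_(y <- finmap.enum_fset (fset_set (range (s n))))
    y * \1_(s n @^-1` [set y]) x) :> (X -> R).
  by apply/funext => x; rewrite [LHS]fimfunE fsbig_finite.
apply: test_against_eq0_sum => [y|y]; first by [].
exact: test_against_indic.
Qed.

End vanishing_functional.
End torus_density.

(** * The lemma of du Bois-Reymond in time *)

Section fundamental_lemma.
Variable R : realType.
Local Notation leb := (@lebesgue_measure R).
Implicit Types (T E a b s t : R) (f h chi : R -> R).

Lemma within_continuousM T f h : {within `[0, T], continuous f} ->
  {within `[0, T], continuous h} ->
  {within `[0, T], continuous (fun t => f t * h t)}.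
Proof. by move=> fc hc t; apply: cvgM; [exact: fc|exact: hc]. Qed.

Lemma within_continuousD T f h : {within `[0, T], continuous f} ->
  {within `[0, T], continuous h} ->
  {within `[0, T], continuous (fun t => f t + h t)}.
Proof. by move=> fc hc t; apply: cvgD; [exact: fc|exact: hc]. Qed.

Lemma within_continuous_cst T (c : R) :
  {within `[0, T], continuous (fun _ : R => c)}.
Proof. by move=> t; exact: cvg_cst. Qed.

Lemma smooth_line_within T f : smooth_line f -> {within `[0, T], continuous f}.
Proof.
by move=> sf; apply: continuous_subspaceT; exact: smooth_line_continuous.
Qed.

Lemma smooth_line_affine c e : smooth_line (fun r : R => (r - c) / e).
Proof.
apply: smooth_lineM; last exact: smooth_line_cst.
by apply: smooth_lineB; [exact: smooth_line_id|exact: smooth_line_cst].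
Qed.

Lemma derive1_ge0 f t : smooth_line f -> {homo f : x y / x <= y} ->
  0 <= derive1 f t.
Proof.
move=> sf fh; rewrite derive1E /derive; apply: limr_ge.
  exact: smooth_line_derivable.
near=> e; rewrite /= [e *: _]mulr1.
have [e0|e0|e0] := ltgtP e 0.
- apply: mulr_le0; first by rewrite invr_le0 ltW.
  by rewrite subr_le0 fh// gerDr ltW.
- apply: mulr_ge0; first by rewrite invr_ge0 ltW.
  by rewrite subr_ge0 fh// lerDr ltW.
- by rewrite e0 add0r subrr scaler0.
Unshelve. all: by end_near. Qed.

Lemma derive1_locally_cst f (c t : R) : (\forall r \near t, f r = c) ->
  derive1 f t = 0.
Proof.
move=> fc; rewrite derive1E.
rewrite (near_eq_derive (g := cst c))//; exact: derive_cst.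
Qed.

Lemma Rintegral_derive1 T f : 0 < T -> smooth_line f ->
  \int[leb]_(t in `]0, T[) derive1 f t = f T - f 0.
Proof.
move=> T0 sf; have sf' := smooth_line_derive1 sf.
have cf := smooth_line_continuous sf.
have i1 : leb.-integrable `]0, T[ (EFin \o derive1 f).
  by apply: within_integrable; exact: smooth_line_within.
rewrite Rintegral_itv_obnd_cbnd// Rintegral_itv_bndo_bndc; last first.
  apply: (@integrableS _ (measurableTypeR R) R leb `[0, T]%classic) => //.
    by move=> r /=; rewrite !in_itv/= => /andP[-> /ltW].
  apply: continuous_compact_integrable; first exact: segment_compact.
  exact: smooth_line_within.
rewrite /Rintegral (@continuous_FTC2 _ _ f)//.
- exact: smooth_line_within.
- split.
  + by move=> r _; exact: smooth_line_derivable.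
  + by apply: cvg_at_right_filter; exact: cf.
  + by apply: cvg_at_left_filter; exact: cf.
Qed.

Definition transition (c e r : R) := step ((r - c) / e).

Lemma smooth_line_transition c e : smooth_line (transition c e).
Proof.
by apply: smooth_line_comp; [exact: smooth_line_step|exact: smooth_line_affine].
Qed.

Lemma transition_le c e r : 0 < e -> r <= c -> transition c e r = 0.
Proof.
move=> e0 rc; rewrite /transition step_le0//.
by rewrite pmulr_lle0 ?invr_gt0// subr_le0.
Qed.

Lemma transition_ge c e r : 0 < e -> c + e <= r -> transition c e r = 1.
Proof.
move=> e0 cer; rewrite /transition step_ge1//.
by rewrite ler_pdivlMr// mul1r lerBrDl.
Qed.

(** The derivative of a steep transition is nonnegative, has mass one and lives
    on [c, c + e]: integrating against it averages the values taken there. *)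
Lemma transition_approximate_unit T (c e : R) h (v eta : R) : 0 < e -> 0 <= c ->
  c + e <= T -> {within `[0, T], continuous h} ->
  (forall r, c <= r <= c + e -> `|h r - v| <= eta) ->
  `|\int[leb]_(t in `]0, T[) (h t * derive1 (transition c e) t) - v| <= eta.
Proof.
move=> e0 c0 ceT hc hv.
have T0 : 0 < T by rewrite (lt_le_trans _ ceT)// ltr_wpDl.
set k := derive1 (transition c e).
have st := smooth_line_transition c e.
have sk : smooth_line k := smooth_line_derive1 st.
have kc : {within `[0, T], continuous k} := smooth_line_within sk.
have k0 r : 0 <= k r.
  apply: derive1_ge0 => // x y xy; apply: step_nondecreasing.
  by rewrite ler_pM2r ?invr_gt0// lerD2r.
have kE r : ~~ (c <= r <= c + e) -> k r = 0.
  rewrite negb_and -!ltNge => /orP[rc|cr].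
    apply: (@derive1_locally_cst _ 0); near=> z; apply: transition_le => //.
    by apply/ltW; near: z; exact: lt_nbhsl.
  apply: (@derive1_locally_cst _ 1); near=> z; apply: transition_ge => //.
  by apply/ltW; near: z; exact: lt_nbhsr.
have ik : leb.-integrable `]0, T[ (EFin \o k) by exact: within_integrable.
have k1 : \int[leb]_(t in `]0, T[) k t = 1.
  rewrite Rintegral_derive1// (transition_ge e0 ceT) (transition_le e0 c0).
  by rewrite subr0.
have mI : @measurable _ (measurableTypeR R) `]0, T[%classic by [].
have ihk : leb.-integrable `]0, T[ (EFin \o (fun t => h t * k t)).
  by apply: within_integrable; exact: within_continuousM.
have ivk (w : R) : leb.-integrable `]0, T[ (EFin \o (fun t => w * k t)).
  apply: within_integrable; apply: within_continuousM => //.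
  exact: within_continuous_cst.
have -> : v = \int[leb]_(t in `]0, T[) (v * k t) by rewrite RintegralZl// k1 mulr1.
rewrite -RintegralB//.
have ihv : leb.-integrable `]0, T[ (EFin \o (fun t => h t * k t - v * k t)).
  by have := integrableB mI ihk (ivk v); apply: eq_integrable.
apply: (le_trans (le_normr_Rintegral _ _)) => //.
have -> : eta = \int[leb]_(t in `]0, T[) (eta * k t).
  by rewrite RintegralZl// k1 mulr1.
apply: le_Rintegral => //; first exact: integrable_norm ihv.
move=> r _; rewrite -mulrBl normrM (ger0_norm (k0 r)).
have [cr|/kE ->] := boolP (c <= r <= c + e); last by rewrite !mulr0.
by rewrite ler_wpM2r// hv.
Unshelve. all: by end_near. Qed.

(** The lemma of du Bois-Reymond in a quantitative form: testing with a smooth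
    cut-off of the indicator of an interval recovers the increment over that
    interval.  Subtracting the affine function [E * beta * r] beforehand leaves
    a right-hand side which is small in supremum norm. *)
Lemma weak_derivative_increment T E (A B : R -> R) (beta eps s t : R) :
  0 < E -> 0 <= s -> s < t -> t <= T ->
  {within `[0, T], continuous A} -> {within `[0, T], continuous B} ->
  (forall chi a b, smooth_line chi -> 0 < a -> b < T ->
    (forall r, ~~ (a <= r <= b) -> chi r = 0) ->
    \int[leb]_(r in `]0, T[)
      (- (E^-1 * A r * derive1 chi r) + B r * chi r) = 0) ->
  (forall r, s <= r <= t -> `|B r - beta| <= eps) ->
  `|A t - A s + E * beta * (t - s)| <= E * eps * (t - s).
Proof.
move=> E0 s0 st tT cA cB weak Bbeta.
have T0 : 0 < T by rewrite (le_lt_trans s0)// (lt_le_trans st).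
have mI : @measurable _ (measurableTypeR R) `]0, T[%classic by [].
pose A' r := A r + E * beta * r.
have cid : {within `[0, T], continuous (id : R -> R)}.
  by apply: smooth_line_within; exact: smooth_line_id.
have cA' : {within `[0, T], continuous A'}.
  apply: within_continuousD => //; apply: within_continuousM => //.
  exact: within_continuous_cst.
rewrite (_ : _ + _ = A' t - A' s); last by rewrite /A'; ring.
apply/ler_addgt0Pr => eta eta0.
have eta2 : 0 < eta / 2 by rewrite divr_gt0.
have sT : 0 <= s <= T by rewrite s0 (ltW (lt_le_trans st tT)).
have tT' : 0 <= t <= T by rewrite tT (le_trans s0 (ltW st)).
have [r1 r10 H1] := within_continuous_dist cA' sT eta2.
have [r2 r20 H2] := within_continuous_dist cA' tT' eta2.
have [e [e0 e1 e2 e3]] :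
    exists e, [/\ 0 < e, 4 * e < t - s, 2 * e < r1 & 2 * e < r2].
  exists (Num.min ((t - s) / 5) (Num.min (r1 / 4) (r2 / 4))); split.
  - by rewrite !lt_min !divr_gt0// subr_gt0.
  - rewrite -ltr_pdivlMl// gt_min; apply/orP; left.
    by have := st; clear; lra.
  - rewrite -ltr_pdivlMl// !gt_min; apply/orP; right; apply/orP; left.
    by clear -r10; lra.
  - rewrite -ltr_pdivlMl// !gt_min; apply/orP; right; apply/orP; right.
    by clear -r20; lra.
(* Both transitions take place strictly inside [s, t], so that [chi] is
   admissible even when [s = 0] or [t = T]. *)
pose chi r := transition (s + e) e r - transition (t - 2 * e) e r.
have schi : smooth_line chi.
  by apply: smooth_lineB; exact: smooth_line_transition.
have chi_le1 r : `|chi r| <= 1.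
  rewrite /chi ler_norml /transition.
  have := step_ge0 ((r - (s + e)) / e); have := step_le1 ((r - (s + e)) / e).
  have := step_ge0 ((r - (t - 2 * e)) / e).
  have := step_le1 ((r - (t - 2 * e)) / e).
  move: (step _) (step _) => x y; clear.
  by move=> *; apply/andP; split; lra.
have chi0 r : ~~ (s + e <= r <= t - e) -> chi r = 0.
  rewrite negb_and -!ltNge => /orP[rs|tr]; rewrite /chi.
    by rewrite !transition_le ?subrr//; clear -rs e1 e0; lra.
  by rewrite !transition_ge ?subrr//; clear -tr e1 e0; lra.
have Dchi r : derive1 chi r =
    derive1 (transition (s + e) e) r - derive1 (transition (t - 2 * e) e) r.
  rewrite !derive1E deriveB//; apply: smooth_line_derivable;
  exact: smooth_line_transition.
have cchi : {within `[0, T], continuous chi} := smooth_line_within schi.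
have cdchi : {within `[0, T], continuous (derive1 chi)} :=
  smooth_line_within (smooth_line_derive1 schi).
have ctr c : {within `[0, T], continuous (derive1 (transition c e))} :=
  smooth_line_within (smooth_line_derive1 (smooth_line_transition c e)).
have ccst := @within_continuous_cst T.
have cE1 : {within `[0, T], continuous (fun r => E^-1 * A r * derive1 chi r)}.
  apply: within_continuousM => //; apply: within_continuousM => //; exact: ccst.
have cB1 : {within `[0, T], continuous (fun r => (B r - beta) * chi r)}.
  apply: within_continuousM => //; apply: within_continuousD => //; exact: ccst.
have cA1 : {within `[0, T], continuous (fun r => A' r * derive1 chi r)}.
  exact: within_continuousM.
(* Subtracting [beta] from [B] costs the integral of [(r * chi r)'], which
   vanishes. *)
have weak_id : \int[leb]_(r in `]0, T[) (r * derive1 chi r + chi r) = 0.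
  have sid : smooth_line (fun r => r * chi r).
    by apply: smooth_lineM => //; exact: smooth_line_id.
  have := Rintegral_derive1 T0 sid.
  rewrite mul0r subr0 chi0 ?mulr0; last first.
    by rewrite negb_and -!ltNge; apply/orP; right; clear -tT e0; lra.
  move=> I0; rewrite -[RHS]I0; apply: eq_Rintegral => r _.
  have dchi := @smooth_line_derivable R chi schi r.
  have did := @derivable_id R R^o (r : R) 1.
  rewrite !derive1E (@deriveM R R^o id chi (r : R) 1 did dchi) derive_id.
  by rewrite [chi r *: _]mulr1.
have eqA : \int[leb]_(r in `]0, T[) (A' r * derive1 chi r) =
    E * \int[leb]_(r in `]0, T[) ((B r - beta) * chi r).
  have se0 : 0 < s + e by rewrite ltr_wpDl.
  have teT : t - e < T by clear -tT e0; lra.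
  have W := weak chi _ _ schi se0 teT chi0.
  have cW : {within `[0, T],
      continuous (fun r => - (E^-1 * A r * derive1 chi r) + B r * chi r)}.
    apply: within_continuousD; last exact: within_continuousM.
    by move=> r; apply: cvgN; exact: cE1.
  have cW' : {within `[0, T], continuous (fun r => r * derive1 chi r + chi r)}.
    by apply: within_continuousD => //; exact: within_continuousM.
  have cZ (c : R) h : {within `[0, T], continuous h} ->
      {within `[0, T], continuous (fun r => c * h r)}.
    by move=> ch; apply: within_continuousM => //; exact: ccst.
  have I h : {within `[0, T], continuous h} ->
    leb.-integrable `]0, T[ (EFin \o h) by exact: within_integrable.
  transitivity (\int[leb]_(r in `]0, T[) (E * ((B r - beta) * chi r) +
    (- E * (- (E^-1 * A r * derive1 chi r) + B r * chi r) +
     (E * beta) * (r * derive1 chi r + chi r)))).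
    by apply: eq_Rintegral => r _; rewrite /A'; field; rewrite gt_eqF.
  have c3 := cZ E _ cB1; have c1 := cZ (- E) _ cW; have c2 := cZ (E * beta) _ cW'.
  rewrite RintegralD//; [|exact: (I _ c3)|exact: (I _ (within_continuousD c1 c2))].
  rewrite RintegralD//; [|exact: (I _ c1)|exact: (I _ c2)].
  rewrite RintegralZl//; last exact: (I _ cB1).
  rewrite RintegralZl//; last exact: (I _ cW').
  rewrite RintegralZl//; last exact: (I _ cW).
  by rewrite W weak_id !mulr0 !addr0.
have bound : `|\int[leb]_(r in `]0, T[) (A' r * derive1 chi r)| <=
    E * eps * (t - s).
  rewrite eqA normrM gtr0_norm// -mulrA ler_wpM2l ?(ltW E0)//.
  have -> : \int[leb]_(r in `]0, T[) ((B r - beta) * chi r) =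
      \int[leb]_(r in `]s, t[) ((B r - beta) * chi r).
    rewrite Rintegral_mkcond [RHS]Rintegral_mkcond; congr Rintegral.
    apply/funext => r; rewrite /patch.
    have [rse|/chi0 ->] := boolP (s + e <= r <= t - e); last first.
      by rewrite mulr0; do 2 case: ifP.
    rewrite !mem_setE !in_itv/= !ifT//; apply/andP; split;
      by move: rse; clear -s0 tT e0 => /andP[? ?]; lra.
  have mJ : @measurable _ (measurableTypeR R) `]s, t[%classic by [].
  have iJ : leb.-integrable `]s, t[ (EFin \o (fun r => (B r - beta) * chi r)).
    apply: (@integrableS _ (measurableTypeR R) R leb `]0, T[%classic) => //.
      move=> r /=; rewrite !in_itv/= => /andP[sr rt].
      by rewrite (le_lt_trans s0 sr) (lt_le_trans rt tT).
    exact: within_integrable cB1.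
  have iJc (c : R) : leb.-integrable `]s, t[ (EFin \o (fun _ : R => c)).
    apply: (@integrableS _ (measurableTypeR R) R leb `]0, T[%classic) => //.
      move=> r /=; rewrite !in_itv/= => /andP[sr rt].
      by rewrite (le_lt_trans s0 sr) (lt_le_trans rt tT).
    exact: within_integrable (ccst c).
  apply: (le_trans (le_normr_Rintegral _ _)) => //.
  apply: (@le_trans _ _ (\int[leb]_(r in `]s, t[) eps)).
    apply: le_Rintegral => //; first exact: integrable_norm iJ.
    move=> r /=; rewrite in_itv/= => /andP[sr rt].
    rewrite normrM -[leRHS]mulr1 ler_pM//.
    by apply: Bbeta; rewrite (ltW sr) (ltW rt).
  have lst : leb `]s, t[%classic = (t - s)%:E.
    by rewrite lebesgue_measure_itv /= lte_fin st.
  by rewrite Rintegral_cst// -[leRHS]/(eps * fine (t - s)%:E) -lst.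
have split2 : \int[leb]_(r in `]0, T[) (A' r * derive1 chi r) =
    \int[leb]_(r in `]0, T[) (A' r * derive1 (transition (s + e) e) r) -
    \int[leb]_(r in `]0, T[) (A' r * derive1 (transition (t - 2 * e) e) r).
  have iA c := within_integrable (within_continuousM cA' (ctr c)).
  rewrite -RintegralB//.
  by apply: eq_Rintegral => r _; rewrite Dchi mulrBr.
have K1 : `|\int[leb]_(r in `]0, T[) (A' r * derive1 (transition (s + e) e) r)
    - A' s| <= eta / 2.
  apply: transition_approximate_unit => //.
  - by rewrite addr_ge0// ltW.
  - by clear -tT e1 e0; lra.
  - move=> r /andP[sr rs]; apply: H1.
      by apply/andP; split; clear -s0 tT e1 e0 sr rs; lra.
    by rewrite ltr_norml; apply/andP; split; clear -e0 e2 sr rs; lra.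
have K2 : `|\int[leb]_(r in `]0, T[) (A' r * derive1 (transition (t - 2 * e) e) r)
    - A' t| <= eta / 2.
  apply: transition_approximate_unit => //.
  - by clear -s0 e1 e0; lra.
  - by clear -tT e1 e0; lra.
  - move=> r /andP[sr rs]; apply: H2.
      by apply/andP; split; clear -s0 tT e1 e0 sr rs; lra.
    by rewrite ltr_norml; apply/andP; split; clear -e0 e3 sr rs; lra.
rewrite split2 in bound.
have triangle (x y a b c h : R) : `|x - a| <= h / 2 -> `|y - b| <= h / 2 ->
    `|x - y| <= c -> `|b - a| <= c + h.
  clear; rewrite !ler_norml => /andP[? ?] /andP[? ?] /andP[? ?].
  by apply/andP; split; lra.
exact: triangle K1 K2 bound.
Qed.

End fundamental_lemma.

(** * Lebesgue and Sobolev spaces of the torus *)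

Section torus_spaces.
Variable R : realType.
Local Notation X := (measurableTypeR R * measurableTypeR R)%type.
Local Notation mu := (@torus_measure R).
Local Notation leb := (@lebesgue_measure R).
Implicit Types (f g h phi : R * R -> R) (T : R).

Lemma torus_L_measurable p f : torus_L p f -> measurable_fun setT (f : X -> R).
Proof. by move=> [_ /sub_Lfun_mfun]; rewrite inE. Qed.

Lemma torus_L2_integrable_sqr f : torus_L 2%:E f ->
  integrable1 mu (fun x => f x ^+ 2).
Proof. by move=> [_ /Lfun2_integrable_sqr]. Qed.

Lemma torus_L1_integrable f : torus_L 1%:E f -> integrable1 mu (f : X -> R).
Proof. by move=> [_ /Lfun1_integrable]. Qed.

Lemma torus_L2_integrable f : torus_L 2%:E f -> integrable1 mu (f : X -> R).
Proof.
move=> fL; apply: (le_integrable1 (g := fun x : X => 1 + f x ^+ 2)).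
- exact: torus_L_measurable fL.
- move=> x; rewrite ler_norml; have := sqr_ge0 (f x - 1); have := sqr_ge0 (f x + 1).
  by move=> *; apply/andP; split; nra.
- apply: integrable1D; last exact: torus_L2_integrable_sqr.
  exact: finite_measure_integrable_cst.
Qed.

Lemma torus_L2B f g : torus_L 2%:E f -> torus_L 2%:E g ->
  torus_L 2%:E (fun x => f x - g x).
Proof.
move=> [pf fL] [pg gL]; split; first by move=> i x; rewrite pf pg.
have le12 : (1 <= 2%:E :> \bar R)%E by rewrite lee_fin ler1n.
have [_ clo] := Lfun_submod_closed mu le12.
have -> : (fun x => f x - g x) = (-1 *: (g : X -> R) + f) :> (X -> R).
  by apply/funext => x; rewrite [RHS]addrC; congr (_ + _); exact/esym/mulN1r.
exact: clo.
Qed.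

Lemma Rintegral_sqr_le_L2norm f (e : R) : 0 <= e -> (L2norm f <= e%:E)%E ->
  \int[mu]_x (f x ^+ 2) <= e ^+ 2.
Proof.
move=> e0 fe.
have I2 : (\int[mu]_x (f x ^+ 2)%:E <= (e ^+ 2)%:E)%E.
  have -> : (\int[mu]_x (f x ^+ 2)%:E = L2norm f `^ 2)%E.
    rewrite /L2norm poweR_Lnorm ?pnatr_eq0//.
    apply: eq_integral => x _; rewrite /= powR_mulrn//.
    by rewrite real_normK// num_real.
  rewrite -powR_mulrn// -poweR_EFin; apply: gt0_ler_poweR => //.
    by rewrite in_itv/= leey Lnorm_ge0.
  by rewrite in_itv/= leey lee_fin e0.
have I0 : (0 <= \int[mu]_x (f x ^+ 2)%:E)%E.
  by apply: integral_ge0 => x _; rewrite lee_fin sqr_ge0.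
rewrite -lee_fin /Rintegral fineK// ge0_fin_numE//.
exact: le_lt_trans I2 (ltry _).
Qed.

Lemma cvg0_within_dist T (h : R -> \bar R) (s : R) :
  h t @[t --> within `[0, T] (nbhs s)] --> 0%E ->
  forall e : R, 0 < e -> exists2 r, 0 < r &
    forall t, 0 <= t <= T -> `|t - s| < r -> (h t <= e%:E)%E.
Proof.
move=> /fine_cvgP[hfin /cvgr0Pnorm_le hcvg] e e0.
have : \forall t \near within `[0, T] (nbhs s), (h t <= e%:E)%E.
  near=> t; have hf : h t \is a fin_num by near: t.
  rewrite -(fineK hf) lee_fin (le_trans (ler_norm _))//.
  by near: t; exact: hcvg.
rewrite near_withinE => -[r /= r0 H]; exists r => // t tT ts.
by apply: H; rewrite //= distrC.
Unshelve. all: by end_near. Qed.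

Lemma L2_continuous_of_dist T (v : R -> R * R -> R) :
  (forall t, 0 <= t <= T -> torus_L 2%:E (v t)) ->
  (forall s, 0 <= s <= T -> forall e : R, 0 < e -> exists2 r, 0 < r &
    forall t, 0 <= t <= T -> `|t - s| < r ->
    \int[mu]_x (v t x - v s x) ^+ 2 <= e ^+ 2) ->
  L2_continuous mu T v.
Proof.
move=> vL vc; split=> [t tT|t tT|s sT e e0].
- by apply: torus_L_measurable; exact: vL.
- by apply: torus_L2_integrable_sqr; exact: vL.
have se0 : 0 < Num.sqrt e by rewrite sqrtr_gt0.
have [r r0 H] := vc s sT _ se0; exists r => // t tT ts.
by rewrite -(sqr_sqrtr (ltW e0)); exact: H.
Qed.

Lemma C_L2_continuous T (v : R -> R * R -> R) : C_L2 T v -> L2_continuous mu T v.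
Proof.
move=> [vL vc]; apply: L2_continuous_of_dist => // s sT e e0.
have [r r0 H] := cvg0_within_dist (vc s sT) e0; exists r => // t tT ts.
by have := Rintegral_sqr_le_L2norm (ltW e0) (H t tT ts).
Qed.

(** By density the identity holds for the bounded function [sign h], and then
    says that [h] has norm zero. *)
Lemma ae_eq0_of_tests h : integrable1 mu h ->
  (forall phi, torus_test phi -> \int[mu]_x (h x * phi x) = 0) ->
  {ae mu, forall x, h x = 0}.
Proof.
move=> h1 htest; apply: ae_eq0_of_Rintegral_norm => //.
have mh := integrable1_measurable h1.
have hc : L1_continuous mu 1 (fun _ => h).
  split=> // s _ e e0; exists 1 => // t _ _.
  by rewrite (_ : (fun x => _) = cst 0) ?Rintegral_cst ?mul0r ?(ltW e0)//;
    apply/funext => x; rewrite subrr normr0.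
pose sgn (x : X) : R := \1_[set y | 0 < h y] x + -1 * \1_[set y | h y < 0] x.
have bsgn : bounded_measurable sgn.
  apply: bounded_measurableD; last apply: bounded_measurableZ;
    apply: bounded_measurable_indic.
    rewrite (_ : [set y | _] = h @^-1` `]0, +oo[%classic).
      by rewrite -[X in measurable X]setTI; exact: mh.
    by apply/seteqP; split=> x /=; rewrite in_itv/= andbT.
  rewrite (_ : [set y | _] = h @^-1` `]-oo, 0[%classic).
    by rewrite -[X in measurable X]setTI; exact: mh.
  by apply/seteqP; split=> x /=; rewrite in_itv/=.
have := test_against_eq0 hc _ bsgn; rewrite /test_against => /(_ _)/wrap[].
  move=> p q sp sq pp pq.
  rewrite (_ : (fun _ => _) = cst 0) ?Rintegral_cst ?mul0r//.
  by apply/funext => t; apply: htest; exact: torus_test_tensor.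
have hs x : h x * sgn x = `|h x|.
  rewrite /sgn !indicE; have [h0|h0|h0] := ltgtP (h x) 0.
  - rewrite memNset ?mem_set//=; last by rewrite ltNge (ltW h0).
    by rewrite mulr1 add0r mulrN1 ltr0_norm.
  - rewrite mem_set// memNset//=; last by rewrite ltNge (ltW h0).
    by rewrite mulr0 addr0 mulr1 gtr0_norm.
  - by rewrite h0 mul0r normr0.
under eq_Rintegral => t _ do under eq_Rintegral => x _ do rewrite hs.
rewrite Rintegral_cst//= lebesgue_measure_itv /= lte_fin ltr01 /= subr0 mulr1.
by move=> ->.
Qed.

Lemma is_weak_deriv_H1 i f : H1 f -> is_weak_deriv i f (weak_deriv i f).
Proof. by move=> [_ /(_ i)[g fg]]; exact: (xgetPex (cst 0) (ex_intro _ g fg)). Qed.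

(** The plane is second countable: an open set is the union of the rational
    squares that it contains, hence belongs to the product sigma-algebra. *)
Lemma measurable_open_plane (U : set (R * R)) : open U -> @measurable _ X U.
Proof.
move=> oU.
pose side n (p : rat) : set R := `]ratr p - n.+1%:R^-1, ratr p + n.+1%:R^-1[%classic.
pose box n p q : set (R * R) := side n p `*` side n q.
have -> : U = \bigcup_n \bigcup_p \bigcup_q
    (if pselect (box n p q `<=` U) then box n p q else set0).
  apply/seteqP; split=> [[x1 x2] Ux|x [n _ [p _ [q _]]]]; last first.
    by case: pselect => // sub; exact: sub.
  have /nbhs_ballP[e /= e0 eU] : nbhs (x1, x2) U by exact: open_nbhs_nbhs.
  have [n ne] : exists n, n.+1%:R^-1 < e / 2.
    have e20 : 0 < e / 2 by rewrite divr_gt0.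
    have /cvgr0Pnorm_lt /(_ _ e20) [n _ /(_ n (leqnn n))] := @cvg_harmonic R.
    by rewrite /= ger0_norm//; exists n.
  have n0 : (0 : R) < n.+1%:R^-1 by rewrite invr_gt0.
  have near_rat (y : R) : exists p, side n p y /\
      forall z, side n p z -> `|y - z| < e.
    have /rat_in_itvoo[p] : y - n.+1%:R^-1 < y + n.+1%:R^-1.
      by rewrite ltrD2l gtrN.
    rewrite /side; move: n0 ne; move: (n.+1%:R^-1) => d d0 de.
    rewrite in_itv/= => /andP[p1 p2].
    exists p; rewrite /= in_itv/=; split.
      by apply/andP; split; clear -p1 p2; lra.
    move=> z; rewrite /= in_itv/= ltr_norml => /andP[z1 z2].
    by apply/andP; split; clear -p1 p2 z1 z2 de; lra.
  have [p [px pe]] := near_rat x1; have [q [qx qe]] := near_rat x2.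
  exists n => //; exists p => //; exists q => //.
  case: pselect => [sub|nsub] /=; first by split.
  apply: nsub => -[y1 y2] [/= /pe y1e /qe y2e]; apply: eU; split => //.
apply: bigcupT_measurable => n; apply: bigcupT_measurable_rat => p.
apply: bigcupT_measurable_rat => q.
case: pselect => [sub|nsub] /=; last exact: measurable0.
by apply: measurableX; exact: measurable_itv.
Qed.

Lemma measurable_continuous_plane f : continuous f ->
  measurable_fun setT (f : X -> R).
Proof.
move=> cf; apply: (measurability _ (RGenOInfty.measurableE R)).
move=> _ [_ [a ->] <-]; rewrite setTI; apply: measurable_open_plane.
by apply: open_comp => [x _|]; [exact: cf|exact: interval_open].
Qed.

Lemma continuous_bounded_torus f : continuous f ->
  exists C, {ae mu, forall x, `|f x| <= C}.
Proof.
move=> cf.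
have cK : compact (`[0, 1]%classic `*` `[0, 1]%classic : set (R * R)).
  by apply: compact_setX; exact: segment_compact.
have /compact_bounded[M [_ fM]] := continuous_compact (continuous_subspaceT cf) cK.
exists (M + 1); apply: (ae_sub (ae_torus_fundamental R)).
move=> [x1 x2] /= [/andP[x10 x11] /andP[x20 x21]].
apply: fM; first by rewrite ltrDl.
by exists (x1, x2) => //; split; rewrite /= in_itv/= ?x10 ?x20 /= ltW.
Qed.

(** On the plane [phi] need not be bounded, but it is on the compact closure of
    the fundamental domain: clamping it changes it on a null set only. *)
Lemma integrable1_mul_test f phi : torus_L 2%:E f -> continuous phi ->
  integrable1 mu (fun x => f x * phi x).
Proof.
move=> fL cphi; have mphi := measurable_continuous_plane cphi.
have mf := torus_L_measurable fL.
have [C phiC] := continuous_bounded_torus cphi.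
pose psi x := Num.max (- C) (Num.min C (phi x)).
have mpsi : measurable_fun setT (psi : X -> R).
  by apply: measurable_maxr => //; exact: measurable_minr.
apply: (@ae_eq_integrable1 _ _ _ mu _ (fun x => f x * psi x)).
- exact: measurable_funM.
- apply: (ae_sub phiC) => x; rewrite ler_norml => /andP[Cphi phiCx].
  by rewrite /psi min_r// max_r.
- apply: (integrable1_Mbounded (C := `|C|)) => //.
    exact: torus_L2_integrable.
  have CC := ler_norm C; have NC : - C <= `|C| by rewrite -normrN ler_norm.
  move=> x; rewrite ler_norml /psi le_max ge_max ge_min CC NC /=.
  by rewrite lerN2 CC.
Qed.

Lemma torus_test_continuous phi : torus_test phi -> continuous phi.
Proof. by move=> [/(_ [::])[]]. Qed.

Lemma torus_test_derive_continuous i phi : torus_test phi ->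
  continuous ('D_(torus_dir R i) phi).
Proof.
move=> [/(_ [:: torus_dir R i])[] // v].
by rewrite inE => /eqP ->; exact: mem_torus_dir.
Qed.

Lemma weak_deriv_unique i f g h : is_weak_deriv i f g -> is_weak_deriv i f h ->
  {ae mu, forall x, g x = h x}.
Proof.
move=> [gL gE] [hL hE].
have ghL := torus_L2B gL hL.
have gh0 : {ae mu, forall x, g x - h x = 0}.
  apply: ae_eq0_of_tests; first exact: torus_L2_integrable.
  move=> phi tphi; have cphi := torus_test_continuous tphi.
  under eq_Rintegral do rewrite mulrBl.
  rewrite RintegralB//; [|exact: integrable1_mul_test..].
  apply/eqP; rewrite subr_eq0 -eqr_opp; apply/eqP.
  by rewrite -gE// -hE.
by apply: (ae_sub gh0) => x /eqP; rewrite subr_eq0 => /eqP.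
Qed.

Lemma is_weak_derivB i f f' g g' : torus_L 2%:E f -> torus_L 2%:E f' ->
  is_weak_deriv i f g -> is_weak_deriv i f' g' ->
  is_weak_deriv i (fun x => f x - f' x) (fun x => g x - g' x).
Proof.
move=> fL fL' [gL gE] [gL' gE']; split; first exact: torus_L2B.
move=> phi tphi; have cphi := torus_test_continuous tphi.
have cdphi := @torus_test_derive_continuous i _ tphi.
under eq_Rintegral do rewrite mulrBl.
under [in RHS]eq_Rintegral do rewrite mulrBl.
rewrite RintegralB//; [|exact: integrable1_mul_test..].
rewrite RintegralB//; [|exact: integrable1_mul_test..].
by rewrite gE// gE'//; ring.
Qed.

Lemma H1B f g : H1 f -> H1 g -> H1 (fun x => f x - g x).
Proof.
move=> Hf Hg; split; first by apply: torus_L2B; [exact: Hf.1|exact: Hg.1].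
move=> i; exists (fun x => weak_deriv i f x - weak_deriv i g x).
apply: is_weak_derivB; [exact: Hf.1|exact: Hg.1| |]; exact: is_weak_deriv_H1.
Qed.

Lemma weak_derivB i f g : H1 f -> H1 g ->
  {ae mu, forall x, weak_deriv i (fun y => f y - g y) x =
    weak_deriv i f x - weak_deriv i g x}.
Proof.
move=> Hf Hg; apply: (@weak_deriv_unique i (fun y => f y - g y)).
  by apply: is_weak_deriv_H1; exact: H1B.
apply: is_weak_derivB; [exact: Hf.1|exact: Hg.1| |]; exact: is_weak_deriv_H1.
Qed.

(** The [H^1] norm controls each weak derivative. *)
Lemma le_hypot (x : \bar R) (w : 'I_2 -> \bar R) i : (0 <= x)%E ->
  (forall j, (0 <= w j)%E) ->
  (w i <= (x ^+ 2 + \sum_(j < 2) w j ^+ 2) `^ 2^-1)%E.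
Proof.
move=> x0 w0; have sq (y : \bar R) : (0 <= y)%E -> (0 <= y ^+ 2)%E.
  by move=> y0; rewrite expe2 mule_ge0.
have {1}-> : w i = ((w i ^+ 2) `^ 2^-1)%E.
  case: (w i) (w0 i) => [r||//]; rewrite ?lee_fin => r0.
    rewrite -EFin_expe poweR_EFin powR12_sqrt ?sqr_ge0//.
    by rewrite sqrtr_sqr ger0_norm.
  by rewrite expe2 mulyy poweRyr.
have s0 (A : pred 'I_2) : (0 <= \sum_(j < 2 | A j) w j ^+ 2)%E.
  by apply: sume_ge0 => j _; rewrite sq.
apply: gt0_ler_poweR => //.
- by rewrite in_itv/= leey andbT sq.
- by rewrite in_itv/= leey andbT adde_ge0 ?sq.
- rewrite (bigD1 i)//= addeCA leeDl//; apply: adde_ge0 => //; exact: sq.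
Qed.

Lemma L2norm_weak_deriv_le i f : (L2norm (weak_deriv i f) <= H1norm f)%E.
Proof.
by apply: (le_hypot (w := fun j => L2norm (weak_deriv j f))) => [|j];
  exact: Lnorm_ge0.
Qed.

Lemma C_H1_continuous T (v : R -> R * R -> R) i : C_H1 T v ->
  L2_continuous mu T (fun t => weak_deriv i (v t)).
Proof.
move=> [vH vc].
have wL t : 0 <= t <= T -> torus_L 2%:E (weak_deriv i (v t)).
  by move=> tT; have [] := is_weak_deriv_H1 i (vH t tT).
apply: L2_continuous_of_dist => // s sT e e0.
have [r r0 H] := cvg0_within_dist (vc s sT) e0; exists r => // t tT ts.
have := Rintegral_sqr_le_L2norm (ltW e0)
  (le_trans (L2norm_weak_deriv_le i _) (H t tT ts)).
apply: le_trans; rewrite le_eqVlt; apply/orP; left; apply/eqP.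
have Hts := is_weak_deriv_H1 i (H1B (vH t tT) (vH s sT)).
apply: Rintegral_ae_eq.
- by apply: measurable_funX; apply: measurable_funB; apply: torus_L_measurable;
    exact: wL.
- by apply: measurable_funX; exact: torus_L_measurable Hts.1.
- by apply: (ae_sub (weak_derivB i (vH t tT) (vH s sT))) => x ->.
Qed.

End torus_spaces.

(** * Increments of solutions of a weak evolution equation *)

Section weak_equation.
Variable R : realType.
Local Notation X := (measurableTypeR R * measurableTypeR R)%type.
Local Notation mu := (@torus_measure R).
Local Notation leb := (@lebesgue_measure R).

(** The distributional equation [E^-1 * w' + f = 0], tested with products of
    functions of one variable, extends to bounded functions of space by density;
    then [t |-> <w t, g>] has the derivative [- E * <f t, g>]. *)
Lemma increment_against_bounded (T E : R) (w f : R -> X -> R) (g : X -> R)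
    (beta eps s t : R) : 0 < E -> 0 <= s -> s < t -> t <= T ->
  L1_continuous mu T w -> L1_continuous mu T f ->
  (forall chi a b p q, smooth_line chi -> 0 < a -> b < T ->
    (forall r, ~~ (a <= r <= b) -> chi r = 0) ->
    smooth_line p -> smooth_line q ->
    (forall x, p (x + 1) = p x) -> (forall x, q (x + 1) = q x) ->
    \int[leb]_(r in `]0, T[) \int[mu]_x
      ((- (E^-1 * w r x * derive1 chi r) + f r x * chi r) * tensor p q x) = 0) ->
  measurable_fun setT g -> (forall x, `|g x| <= 1) ->
  (forall r, s <= r <= t -> `|\int[mu]_x (f r x * g x) - beta| <= eps) ->
  `|\int[mu]_x (w t x * g x) - \int[mu]_x (w s x * g x) + E * beta * (t - s)|
    <= E * eps * (t - s).
Proof.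
move=> E0 s0 st tT wc fc weak mg g1 gbeta.
apply: (@weak_derivative_increment _ T E (fun r => \int[mu]_x (w r x * g x))
  (fun r => \int[mu]_x (f r x * g x))) => //.
- exact: L1_continuous_within wc mg g1.
- exact: L1_continuous_within fc mg g1.
move=> chi a b schi a0 bT chi0.
pose L r x := - (E^-1 * w r x * derive1 chi r) + f r x * chi r.
have cchi : {within `[0, T], continuous chi} := smooth_line_within schi.
have cdchi : {within `[0, T], continuous (derive1 chi)} :=
  smooth_line_within (smooth_line_derive1 schi).
have Lc : L1_continuous mu T L.
  rewrite (_ : L = fun r x => (- E^-1 * derive1 chi r) * w r x + chi r * f r x).
    apply: L1_continuousD; apply: L1_continuousM => //.
    by apply: within_continuousM => //; exact: within_continuous_cst.
  by apply/funext => r; apply/funext => x; rewrite /L; ring.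
have bg : bounded_measurable g by split=> //; exists 1.
have L0 : test_against T L g = 0.
  apply: test_against_eq0 => // p q sp sq pp pq.
  exact: weak schi a0 bT chi0 sp sq pp pq.
rewrite -[RHS]L0; apply: eq_Rintegral => r; rewrite inE => /itv_cc_oo rT.
have wg := integrable1_Mbounded (wc.1 _ rT) mg g1.
have fg := integrable1_Mbounded (fc.1 _ rT) mg g1.
symmetry; transitivity (\int[mu]_x ((- E^-1 * derive1 chi r) * (w r x * g x) +
    chi r * (f r x * g x))).
  by apply: eq_Rintegral => x _; rewrite /L; ring.
rewrite RintegralD//; [|exact: integrable1Z|exact: integrable1Z].
by rewrite !RintegralZl//; ring.
Qed.

End weak_equation.

(** * Convexity and dissipation for two-by-two matrices *)

Section frobenius.
Variable R : realType.
Implicit Types (A B : 'M[R]_2).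

Lemma I2_cases (k : 'I_2) : k = 0 \/ k = 1.
Proof. by case: k => [[|[|//]] ?]; [left|right]; exact: val_inj. Qed.

Lemma sum_I2 (F : 'I_2 -> R) : \sum_i F i = F 0 + F 1.
Proof. by rewrite big_ord_recl big_ord1; congr (_ + F _); exact: val_inj. Qed.

Lemma eucl_norm_ge0 A : 0 <= eucl_norm A.
Proof. exact: sqrtr_ge0. Qed.

Lemma eucl_norm_sqr A : eucl_norm A ^+ 2 =
  A 0 0 ^+ 2 + A 0 1 ^+ 2 + A 1 0 ^+ 2 + A 1 1 ^+ 2.
Proof.
rewrite /eucl_norm sqr_sqrtr; last first.
  by apply: sumr_ge0 => i _; apply: sumr_ge0 => j _; rewrite sqr_ge0.
by rewrite !sum_I2 !real_normK ?num_real// addrA.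
Qed.

Lemma frobenius_dot_le A B :
  \sum_i \sum_j A i j * B i j <= eucl_norm A * eucl_norm B.
Proof.
rewrite !sum_I2; set l := (X in X <= _).
have [l0|l0] := leP l 0; first by rewrite (le_trans l0)// mulr_ge0 ?eucl_norm_ge0.
rewrite -(ler_pXn2r (n := 2)) ?nnegrE ?mulr_ge0 ?eucl_norm_ge0 ?(ltW l0)//.
rewrite exprMn !eucl_norm_sqr /l.
move: (A 0 0) (A 0 1) (A 1 0) (A 1 1) (B 0 0) (B 0 1) (B 1 0) (B 1 1).
clear => a b c d a' b' c' d'; rewrite -subr_ge0.
rewrite (_ : _ - _ = (a * b' - b * a') ^+ 2 + (a * c' - c * a') ^+ 2 +
  (a * d' - d * a') ^+ 2 + (b * c' - c * b') ^+ 2 + (b * d' - d * b') ^+ 2 +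
  (c * d' - d * c') ^+ 2); last by ring.
by rewrite !addr_ge0 ?sqr_ge0.
Qed.

Lemma normr_entry_le A i j : `|A i j| <= eucl_norm A.
Proof.
rewrite -(ler_pXn2r (n := 2)) ?nnegrE ?normr_ge0 ?eucl_norm_ge0//.
rewrite real_normK ?num_real// eucl_norm_sqr.
have := sqr_ge0 (A 0 0); have := sqr_ge0 (A 0 1).
have := sqr_ge0 (A 1 0); have := sqr_ge0 (A 1 1).
by case: (I2_cases i) => ->; case: (I2_cases j) => ->; move=> *; lra.
Qed.

Lemma eucl_norm_le_sum (A : 'M[R]_2) : eucl_norm A <= \sum_i \sum_j `|A i j|.
Proof.
have s0 : 0 <= \sum_i \sum_j `|A i j|.
  by apply: sumr_ge0 => i _; exact: sumr_ge0.
rewrite -(ler_pXn2r (n := 2)) ?nnegrE ?eucl_norm_ge0//.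
rewrite eucl_norm_sqr !sum_I2.
rewrite -!(real_normK (num_real (A _ _))).
move: (normr_ge0 (A 0 0)) (normr_ge0 (A 0 1)) (normr_ge0 (A 1 0))
  (normr_ge0 (A 1 1)).
move: `|A 0 0| `|A 0 1| `|A 1 0| `|A 1 1| => a b c d a0 b0 c0 d0.
rewrite -subr_ge0 (_ : _ - _ = 2 * (a * b + a * c + a * d + b * c + b * d + c * d)).
  by rewrite mulr_ge0// !addr_ge0// mulr_ge0.
by ring.
Qed.

(** For a solution this sum is, up to the factor [- E], the time derivative of
    [|A|^2 / 2].  The constant pressure term costs at most [D * |A|], the strain
    [S] another [D * |A|], and the damping gains at least [D * |A|^2 / P]: hence
    the threshold [2 * P]. *)
Lemma relaxation_dissipative (P D : R) A S : 0 < P -> eucl_norm S <= D ->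
  2 * P <= eucl_norm A ->
  0 <= \sum_i \sum_j A i j *
    (((4 * D / P) *: (A - (2^-1 * \tr A) *: 1%:M) + (D / (2 * P) * \tr A) *: 1%:M
      + (D / 2) *: 1%:M) i j - S i j).
Proof.
move=> P0 SD AP; set n := eucl_norm A in AP *.
have n0 : 0 <= n by exact: eucl_norm_ge0.
have D0 : 0 <= D by exact: le_trans (eucl_norm_ge0 S) SD.
have AS : \sum_i \sum_j A i j * S i j <= n * D.
  by apply: (le_trans (frobenius_dot_le A S)); rewrite ler_wpM2l.
have nE := eucl_norm_sqr A; rewrite -/n in nE.
rewrite /mxtrace !sum_I2 in AS *; rewrite !mxE /= !mulr1n !mulr0n.
move: nE AS; move: (A 0 0) (A 0 1) (A 1 0) (A 1 1) (S 0 0) (S 0 1) (S 1 0) (S 1 1).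
move: n n0 AP; clear -P0 D0 => n n0 AP a b c d a' b' c' d' nE AS.
set xi := a + d.
have xi2 : xi ^+ 2 <= 2 * n ^+ 2.
  have := sqr_ge0 (a - d); have := sqr_ge0 b; have := sqr_ge0 c.
  by rewrite nE /xi; nra.
have xin : - xi <= 2 * n.
  rewrite leNgt; apply/negP => nxi.
  have : (2 * n) ^+ 2 < (- xi) ^+ 2 by rewrite ltr_pXn2r ?nnegrE//; lra.
  by have := sqr_ge0 n; rewrite sqrrN exprMn; lra.
have key : 0 <= D / P * (3 * n ^+ 2 - 3 / 2 * xi ^+ 2).
  by rewrite mulr_ge0 ?divr_ge0 ?(ltW P0)//; lra.
have gain : 2 * (D * n) <= D / P * n ^+ 2.
  rewrite mulrAC ler_pdivlMr// [leLHS](_ : _ = D * n * (2 * P)); last by ring.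
  by rewrite expr2 [leRHS]mulrA ler_wpM2l// mulr_ge0.
have loss : D / 2 * (- xi) <= D * n.
  by rewrite -mulrA ler_wpM2l//; lra.
rewrite [leRHS](_ : _ = D / P * n ^+ 2 + D / P * (3 * n ^+ 2 - 3 / 2 * xi ^+ 2)
  + D / 2 * xi - (a * a' + b * b' + (c * c' + d * d'))).
  by rewrite [n * D]mulrC in AS; rewrite mulrN in loss; lra.
by rewrite nE /xi; field; rewrite gt_eqF.
Qed.

(** Subgradient of [A |-> max (|A| - M) 0]. *)
Definition excess_gradient (M : R) A i j : R :=
  if M < eucl_norm A then A i j / eucl_norm A else 0.

Definition excess (M : R) A : R := Num.max (eucl_norm A - M) 0.

Lemma excess_gradient_le1 M A i j : 0 <= M -> `|excess_gradient M A i j| <= 1.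
Proof.
move=> M0; rewrite /excess_gradient; case: ifP => [MA|_]; last by rewrite normr0.
have A0 := le_lt_trans M0 MA.
by rewrite normrM normfV (gtr0_norm A0) ler_pdivrMr// mul1r normr_entry_le.
Qed.

Lemma excess_ge0 M A : 0 <= excess M A.
Proof. by rewrite le_max lexx orbT. Qed.

(** Outside of the ball this is Cauchy-Schwarz. *)
Lemma excess_subgradient M A B : 0 <= M -> excess M A - excess M B <=
  \sum_i \sum_j excess_gradient M A i j * (A i j - B i j).
Proof.
move=> M0; rewrite /excess_gradient; have [MA|AM] := ltP M (eucl_norm A); last first.
  rewrite !sum_I2 !mul0r !addr0.
  have -> : excess M A = 0 by rewrite /excess max_r// subr_le0.
  by rewrite sub0r oppr_le0 excess_ge0.
have A0 := le_lt_trans M0 MA.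
have AA := eucl_norm_sqr A; have AB := frobenius_dot_le A B.
have -> : excess M A = eucl_norm A - M.
  by rewrite /excess max_l// subr_ge0 ltW.
have eB : eucl_norm B - M <= excess M B by rewrite le_max lexx.
apply: (@le_trans _ _ (eucl_norm A - eucl_norm B)); first by lra.
move: AA AB; rewrite !sum_I2; move: A0; move: (eucl_norm A) (eucl_norm B) => n k.
move=> n0 AA AB; rewrite -(ler_pM2l n0).
rewrite [leRHS](_ : _ = A 0 0 ^+ 2 + A 0 1 ^+ 2 + A 1 0 ^+ 2 + A 1 1 ^+ 2 -
  (A 0 0 * B 0 0 + A 0 1 * B 0 1 + (A 1 0 * B 1 0 + A 1 1 * B 1 1))); last first.
  by field; rewrite gt_eqF.
by rewrite -AA mulrBr expr2 lerD2l lerN2.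
Qed.

End frobenius.

(** * From local to global monotonicity *)

Section local_to_global.
Variable R : realType.

(** Take the supremum of the times up to which [Phi] grows at most at rate [e]:
    the hypothesis at this supremum allows going further. *)
Lemma local_increments_nonincreasing (T : R) (Phi : R -> R) :
  (forall c, 0 <= c <= T -> forall e, 0 < e -> exists2 r, 0 < r &
    forall s t, 0 <= s -> s < t -> t <= T -> `|s - c| < r -> `|t - c| < r ->
    Phi t - Phi s <= e * (t - s)) ->
  forall t, 0 <= t <= T -> Phi t <= Phi 0.
Proof.
move=> loc t /andP[t0 tT].
suff step e : 0 < e -> Phi t - Phi 0 <= e * t.
  apply/ler_addgt0Pr => h h0.
  have t1 : 0 < t + 1 by rewrite ltr_wpDl.
  have := step _ (divr_gt0 h0 t1); rewrite lerBlDr => /le_trans; apply.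
  rewrite addrC lerD2l mulrAC ler_pdivrMr// ler_wpM2l ?(ltW h0)//.
  by rewrite lerDl.
move=> e0.
pose A := [set r : R | 0 <= r <= t /\ Phi r - Phi 0 <= e * r].
have A0 : A 0 by split; rewrite ?lexx ?t0// subrr mulr0.
have ubA : ubound A t by move=> r [/andP[]].
have supA : has_sup A by split; [exists 0|exists t].
set c := sup A.
have c0 : 0 <= c by apply: ub_le_sup => //; exists t.
have ct : c <= t by apply: ge_sup => //; exists 0.
have cT : 0 <= c <= T by rewrite c0 (le_trans ct).
have [r r0 H] := loc c cT e e0.
have [a [/andP[a0 at'] Aa] ca] := sup_adherent r0 supA.
rewrite -/c in ca.
have ac : a <= c by apply: ub_le_sup; [exists t|split=> //; rewrite a0].
have ar : `|a - c| < r.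
  by rewrite ltr_norml; clear -ca ac r0; apply/andP; split; lra.
have ext b : a <= b -> b <= t -> `|b - c| < r -> Phi b - Phi 0 <= e * b.
  rewrite le_eqVlt => /predU1P[<- //|ab] bt br.
  have := H a b a0 ab (le_trans bt tT) ar br.
  by clear -Aa; lra.
pose b := Num.min t (c + r / 2).
have cb : c <= b by rewrite le_min ct lerDl divr_ge0// ltW.
have bt : b <= t by rewrite ge_min lexx.
have bcr : b <= c + r / 2 by rewrite ge_min lexx orbT.
have br : `|b - c| < r.
  by rewrite ltr_norml; clear -cb bcr r0; apply/andP; split; lra.
have Ab : A b.
  split; first by rewrite bt (le_trans c0).
  by apply: ext => //; exact: le_trans ac cb.
have bc : b <= c by apply: ub_le_sup => //; exists t.
have [tb|tb] := leP t b.
  have -> : t = b by apply/eqP; rewrite eq_le tb.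
  exact: Ab.2.
exfalso; move: tb bc; rewrite /b gt_min ltxx /= => tcr.
rewrite min_r; last exact: ltW.
by clear -r0; lra.
Qed.

End local_to_global.

(** * Decay of the total excess *)

Section energy.
Variable R : realType.
Local Notation X := (measurableTypeR R * measurableTypeR R)%type.
Local Notation mu := (@torus_measure R).
Local Notation leb := (@lebesgue_measure R).

Lemma radius_I2 (c : R) (Q : 'I_2 -> 'I_2 -> R -> Prop) :
  (forall i j, exists2 r, 0 < r & forall t, `|t - c| < r -> Q i j t) ->
  exists2 r, 0 < r & forall t, `|t - c| < r -> forall i j, Q i j t.
Proof.
move=> H.
have [a a0 Ha] := H 0 0; have [b b0 Hb] := H 0 1.
have [a' a'0 Ha'] := H 1 0; have [b' b'0 Hb'] := H 1 1.
exists (Num.min (Num.min a b) (Num.min a' b')).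
  by rewrite !lt_min a0 b0 a'0.
move=> t; rewrite !lt_min => /andP[/andP[ta tb] /andP[ta' tb']] i j.
by case: (I2_cases i) => ->; case: (I2_cases j) => ->; auto.
Qed.

Variables (T E M : R) (sigma : R -> R * R -> 'M[R]_2).
Variable F : 'I_2 -> 'I_2 -> R -> X -> R.
Hypotheses (E0 : 0 < E) (M0 : 0 <= M).
Hypothesis sigmac : forall i j, L1_continuous mu T (fun t x => sigma t x i j).
Hypothesis Fc : forall i j, L1_continuous mu T (F i j).
Hypothesis increment : forall i j (g : X -> R) beta eps s t,
  0 <= s -> s < t -> t <= T -> measurable_fun setT g -> (forall x, `|g x| <= 1) ->
  (forall r, s <= r <= t -> `|\int[mu]_x (F i j r x * g x) - beta| <= eps) ->
  `|\int[mu]_x (sigma t x i j * g x) - \int[mu]_x (sigma s x i j * g x)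
    + E * beta * (t - s)| <= E * eps * (t - s).
Hypothesis dissipation : forall t x, 0 <= t <= T -> M < eucl_norm (sigma t x) ->
  0 <= \sum_i \sum_j sigma t x i j * F i j t x.

Lemma measurable_entry t i j : 0 <= t <= T ->
  measurable_fun setT (fun x : X => sigma t x i j).
Proof. by move=> tT; apply: integrable1_measurable; exact: (sigmac i j).1. Qed.

Lemma measurable_eucl_norm t : 0 <= t <= T ->
  measurable_fun setT (fun x : X => eucl_norm (sigma t x)).
Proof.
move=> tT; apply: (measurableT_comp (f := @Num.sqrt R)).
  by apply: continuous_measurable_fun; exact: sqrt_continuous.
apply: measurable_sum => i; apply: measurable_sum => j.
by apply: measurable_funX; apply: measurableT_comp => //; exact: measurable_entry.
Qed.

Lemma integrable1_excess t : 0 <= t <= T ->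
  integrable1 mu (fun x => excess M (sigma t x)).
Proof.
move=> tT; apply: (@le_integrable1 _ _ _ mu _
  (fun x : X => \sum_i \sum_j `|sigma t x i j|)).
- apply: measurable_maxr; last exact: measurable_cst.
  by apply: measurable_funB; [exact: measurable_eucl_norm|exact: measurable_cst].
- move=> x; rewrite ger0_norm ?excess_ge0// /excess ge_max.
  rewrite (le_trans _ (eucl_norm_le_sum _)) ?gerBl//=.
  by apply: sumr_ge0 => i _; exact: sumr_ge0.
- apply: (@integrable1_sum _ _ _ mu _ _ (fun i x => \sum_j `|sigma t x i j|)).
  move=> i; apply: (@integrable1_sum _ _ _ mu _ _ (fun j x => `|sigma t x i j|)).
  by move=> j; apply: integrable1_norm; exact: (sigmac i j).1.
Qed.

Lemma measurable_excess_gradient t i j : 0 <= t <= T ->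
  measurable_fun setT (fun x : X => excess_gradient M (sigma t x) i j).
Proof.
move=> tT; apply: measurable_fun_ifT.
- apply: measurable_fun_ltr; [exact: measurable_cst|exact: measurable_eucl_norm].
- apply: measurable_funM; first exact: measurable_entry.
  under eq_fun do rewrite -powR_inv1 ?eucl_norm_ge0//.
  apply: (measurableT_comp (measurable_powR _)); exact: measurable_eucl_norm.
- exact: measurable_cst.
Qed.

(** Convexity bounds the increment of the total excess between [s] and [t] by
    the increment of [sigma] tested with one bounded field, the subgradient at
    time [t].  By [increment] this is about [- E * (t - s)] times the pairing of
    that field with [F t], which is nonnegative by [dissipation]. *)
Lemma total_excess_nonincreasing t : 0 <= t <= T ->
  \int[mu]_x excess M (sigma t x) <= \int[mu]_x excess M (sigma 0 x).
Proof.
apply: (local_increments_nonincreasing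
  (Phi := fun t => \int[mu]_x excess M (sigma t x))) => {t} c cT e e0.
(* Each of the four entries is off by at most [q] twice: once when [F] is frozen
   at time [c] over [s, t], once when the pairing at [c] replaces that at [t]. *)
pose q := e / (8 * E).
have q0 : 0 < q by rewrite divr_gt0// mulr_gt0.
have [r r0 Hr] : exists2 r, 0 < r & forall t, `|t - c| < r ->
    forall i j, 0 <= t <= T -> \int[mu]_x `|F i j t x - F i j c x| <= q.
  apply: radius_I2 => i j.
  by have [r r0 H] := (Fc i j).2 c cT q q0; exists r => // t tr tT; exact: H.
exists r => // s t s0 st tT sr tr.
have tT' : 0 <= t <= T by rewrite tT (le_trans s0)// ltW.
have sT' : 0 <= s <= T by rewrite s0 (le_trans (ltW st)).
pose g i j x := excess_gradient M (sigma t x) i j.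
have mg i j : measurable_fun setT (g i j : X -> R).
  exact: measurable_excess_gradient.
have g1 i j x : `|g i j x| <= 1 by exact: excess_gradient_le1.
pose beta i j := \int[mu]_x (F i j c x * g i j x).
have close i j z : 0 <= z <= T -> `|z - c| < r ->
    `|\int[mu]_x (F i j z x * g i j x) - beta i j| <= q.
  move=> zT zr.
  apply: (le_trans (L1_continuous_pairing (Fc i j) (mg i j) (g1 i j) cT zT)).
  by rewrite mul1r; exact: Hr.
have incr i j : \int[mu]_x (g i j x * (sigma t x i j - sigma s x i j)) <=
    E * (t - s) * (q - beta i j).
  have st_close z : s <= z <= t ->
      `|\int[mu]_x (F i j z x * g i j x) - beta i j| <= q.
    move=> /andP[sz zt]; apply: close.
      by rewrite (le_trans s0 sz) (le_trans zt tT).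
    move: sr tr; rewrite !ltr_norml => /andP[s1 s2] /andP[t1 t2].
    by apply/andP; split; clear -sz zt s1 s2 t1 t2; lra.
  have := increment s0 st tT (mg i j) (g1 i j) st_close.
  have it := integrable1_Mbounded ((sigmac i j).1 _ tT') (mg i j) (g1 i j).
  have is_ := integrable1_Mbounded ((sigmac i j).1 _ sT') (mg i j) (g1 i j).
  rewrite -RintegralB// ler_norml => /andP[_ up].
  have -> : \int[mu]_x (g i j x * (sigma t x i j - sigma s x i j)) =
      \int[mu]_x (sigma t x i j * g i j x - sigma s x i j * g i j x).
    by apply: eq_Rintegral => x _; ring.
  move: up; move: (\int[mu]_x _) => I up.
  have -> : E * (t - s) * (q - beta i j) =
    E * q * (t - s) - E * beta i j * (t - s) by ring.
  by rewrite lerBrDr.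
have igF i j : integrable1 mu (fun x => F i j t x * g i j x).
  exact: integrable1_Mbounded ((Fc i j).1 _ tT') (mg i j) (g1 i j).
have igS i j : integrable1 mu (fun x => g i j x * (sigma t x i j - sigma s x i j)).
  have := integrable1_Mbounded (integrable1B ((sigmac i j).1 _ tT')
    ((sigmac i j).1 _ sT')) (mg i j) (g1 i j).
  by under eq_fun do rewrite mulrC.
have diss : 0 <= \sum_i \sum_j \int[mu]_x (F i j t x * g i j x).
  under eq_bigr => i _ do rewrite -(Rintegral_sum _ (igF i)).
  rewrite -Rintegral_sum; last by move=> i; exact: integrable1_sum.
  apply: Rintegral_ge0 => x _; rewrite /g /excess_gradient.
  have [Ms|_] := ltP M (eucl_norm (sigma t x)); last first.
    by apply: sumr_ge0 => i _; apply: sumr_ge0 => j _; rewrite mulr0.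
  have := dissipation tT' Ms; rewrite !sum_I2 => D0.
  have n0 : 0 < (eucl_norm (sigma t x))^-1.
    by rewrite invr_gt0 (le_lt_trans M0).
  move: D0; rewrite -(pmulr_rge0 _ n0); congr (0 <= _); ring.
have sum_beta : - (4 * q) <= \sum_i \sum_j beta i j.
  move: diss; rewrite !sum_I2.
  have cl i j := close i j t tT' tr.
  move: (cl 0 0) (cl 0 1) (cl 1 0) (cl 1 1); rewrite !ler_norml.
  move: (Rintegral _ _ _) (Rintegral _ _ _) (Rintegral _ _ _) (Rintegral _ _ _).
  move: (beta 0 0) (beta 0 1) (beta 1 0) (beta 1 1); clear.
  move=> b1 b2 b3 b4 i1 i2 i3 i4 /andP[? ?] /andP[? ?] /andP[? ?] /andP[? ?] ?.
  lra.
rewrite -RintegralB//; try exact: integrable1_excess.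
apply: (@le_trans _ _ (\sum_i \sum_j
    \int[mu]_x (g i j x * (sigma t x i j - sigma s x i j)))).
  under eq_bigr => i _ do rewrite -(Rintegral_sum _ (igS i)).
  rewrite -Rintegral_sum; last by move=> i; exact: integrable1_sum.
  apply: le_Rintegral => //.
  - by apply: integrable1B; exact: integrable1_excess.
  - by apply: integrable1_sum => i; exact: integrable1_sum.
  - by move=> x _; exact: excess_subgradient.
apply: (@le_trans _ _ (\sum_i \sum_j E * (t - s) * (q - beta i j))).
  by apply: ler_sum => i _; apply: ler_sum => j _.
move: sum_beta; rewrite !sum_I2 => sum_beta.
rewrite [leLHS](_ : _ = E * (t - s) *
  (4 * q - (beta 0 0 + beta 0 1 + (beta 1 0 + beta 1 1)))); last by ring.
have -> : e * (t - s) = E * (t - s) * (8 * q).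
  by rewrite /q; field; rewrite gt_eqF.
rewrite ler_wpM2l//; first by rewrite mulr_ge0 ?ltW// subr_gt0.
by move: sum_beta; clear; lra.
Qed.

End energy.

(** * The stress equation *)

Section stress.
Variable R : realType.
Local Notation X := (measurableTypeR R * measurableTypeR R)%type.
Local Notation mu := (@torus_measure R).
Local Notation leb := (@lebesgue_measure R).

Lemma torus_measure_gt0 : (0 < mu setT)%E.
Proof.
rewrite torus_measureT.
have -> : circle_measure (setT : set (measurableTypeR R)) = 1%E.
  rewrite /circle_measure /mfrestr /mrestr setTI /circle lebesgue_measure_itv /=.
  by rewrite lte_fin ltr01 oppr0 addr0.
by rewrite expe2 mule1 lte01.
Qed.

Lemma Linfty_norm_le (A : R * R -> 'M[R]_2) (C : R) :
  {ae mu, forall x, eucl_norm (A x) <= C} -> (Linfty_norm A <= C%:E)%E.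
Proof.
move=> AC; rewrite /Linfty_norm unlock /Lnorm torus_measure_gt0.
apply/ess_supP; apply: (ae_sub AC) => x Ax /=.
by rewrite lee_fin ger0_norm ?eucl_norm_ge0.
Qed.

Lemma Linfty_norm_ge (A : R * R -> 'M[R]_2) :
  {ae mu, forall x, ((eucl_norm (A x))%:E <= Linfty_norm A)%E}.
Proof.
rewrite /Linfty_norm unlock /Lnorm torus_measure_gt0.
apply: (ae_sub (ess_sup_ge mu (abse \o (EFin \o (@eucl_norm R \o A))))) => x /=.
by rewrite ger0_norm ?eucl_norm_ge0.
Qed.

Lemma torus_Linfty_bounded (f : R * R -> R) : torus_L +oo%E f ->
  exists C, {ae mu, forall x, `|f x| <= C}.
Proof.
move=> [_ /sub_Lfun_finLfun]; rewrite inE /= /finite_norm => ffin.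
have f0 : (0 <= 'N[mu]_(+oo)[EFin \o f])%E by exact: Lnorm_ge0.
have fN : 'N[mu]_(+oo)[EFin \o f]%E \is a fin_num by rewrite ge0_fin_numE.
exists (fine ('N[mu]_(+oo)[EFin \o f])%E).
move: fN; rewrite unlock /Lnorm torus_measure_gt0 => fN.
apply: (ae_sub (ess_sup_ge mu (abse \o (EFin \o f)))) => x /=.
by rewrite -{1}(fineK fN) lee_fin.
Qed.

Lemma bounded_torus_Linfty (f : R * R -> R) (C : R) : torus_periodic f ->
  measurable_fun setT (f : X -> R) -> {ae mu, forall x, `|f x| <= C} ->
  torus_L +oo%E f.
Proof.
move=> pf mf fC; split=> //.
rewrite inE; apply/andP; split; first by rewrite inE.
rewrite inE /= /finite_norm unlock /Lnorm torus_measure_gt0.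
apply: (@le_lt_trans _ _ C%:E); last exact: ltry.
by apply/ess_supP; apply: (ae_sub fC) => x fx /=; rewrite lee_fin.
Qed.

Variables (T P E eps : R).
Hypotheses (P_gt0 : 0 < P) (E_gt0 : 0 < E).
Variables (u : R -> R * R -> 'rV[R]_2) (sigma : R -> R * R -> 'M[R]_2).
Hypothesis u_CH1 : forall i, C_H1 T (fun t x => u t x 0 i).
Hypothesis sigma_CL2 : forall i j, C_L2 T (fun t x => sigma t x i j).
Hypothesis sigma_eq : stress_equation T P E eps u sigma.

Lemma symgradE t x i j : symgrad (u t) x i j =
  2^-1 * (weak_deriv j (fun y => u t y 0 i) x + weak_deriv i (fun y => u t y 0 j) x).
Proof. by rewrite !mxE. Qed.

Lemma symgrad_continuous i j :
  L2_continuous mu T (fun t x => symgrad (u t) x i j).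
Proof.
under eq_fun do under eq_fun do rewrite symgradE.
apply: L2_continuousZ; apply: L2_continuousD.
  exact: (C_H1_continuous (v := fun t x => u t x 0 i)).
exact: (C_H1_continuous (v := fun t x => u t x 0 j)).
Qed.

(** Nesting planar norms brings [D_eps] under [L2_continuous_hypot]. *)
Lemma DepsE t x : Deps eps (u t) x =
  let S i j := symgrad (u t) x i j in
  Num.sqrt (Num.sqrt (Num.sqrt (S 0 0 ^+ 2 + S 0 1 ^+ 2) ^+ 2 +
    Num.sqrt (S 1 0 ^+ 2 + S 1 1 ^+ 2) ^+ 2) ^+ 2 + eps ^+ 2).
Proof.
by rewrite /= /Deps eucl_norm_sqr !sqr_sqrtr ?addr_ge0 ?sqr_ge0// !addrA.
Qed.

Lemma Deps_continuous : L2_continuous mu T (fun t x => Deps eps (u t) x).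
Proof.
under eq_fun do under eq_fun do rewrite DepsE.
apply: L2_continuous_hypot; last exact: L2_continuous_cst.
by apply: L2_continuous_hypot; apply: L2_continuous_hypot;
  exact: symgrad_continuous.
Qed.

Definition stress_rate i j t x :=
  relaxation P eps (u t) (sigma t) x i j - symgrad (u t) x i j.

(** Only products of two [L^2]-continuous families occur, so the rate is
    continuous with values in [L^1]. *)
Lemma stress_rateE i j t x : stress_rate i j t x =
  4 / P * (Deps eps (u t) x * sigma t x i j) +
  ((2 * P)^-1 - 2 / P) * (i == j)%:R *
    (Deps eps (u t) x * sigma t x 0 0 + Deps eps (u t) x * sigma t x 1 1) +
  2^-1 * (i == j)%:R * Deps eps (u t) x - symgrad (u t) x i j.
Proof.
rewrite /stress_rate; congr (_ - _).
rewrite /relaxation !mxE /mxtrace sum_I2.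
by case: (i == j); rewrite ?mulr1n ?mulr0n; field; rewrite gt_eqF.
Qed.

Lemma stress_rate_continuous i j : L1_continuous mu T (stress_rate i j).
Proof.
rewrite (_ : stress_rate i j = fun t x =>
  4 / P * (Deps eps (u t) x * sigma t x i j) +
  ((2 * P)^-1 - 2 / P) * (i == j)%:R *
    (Deps eps (u t) x * sigma t x 0 0 + Deps eps (u t) x * sigma t x 1 1) +
  2^-1 * (i == j)%:R * Deps eps (u t) x + -1 * symgrad (u t) x i j); last first.
  by apply/funext => t; apply/funext => x; rewrite stress_rateE mulN1r.
have Ds k l : L1_continuous mu T (fun t x => Deps eps (u t) x * sigma t x k l).
  apply: L2_continuous_mul; first exact: Deps_continuous.
  exact: (C_L2_continuous (v := fun t x => sigma t x k l)).
apply: L1_continuousD; last first.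
  by apply/L1_continuousZ/L2_continuous_L1; exact: symgrad_continuous.
apply: L1_continuousD; last first.
  by apply/L1_continuousZ/L2_continuous_L1; exact: Deps_continuous.
apply: L1_continuousD; first exact: L1_continuousZ.
by apply: L1_continuousZ; exact: L1_continuousD.
Qed.

Lemma stress_increment i j (g : X -> R) (beta e s t : R) :
  0 <= s -> s < t -> t <= T -> measurable_fun setT g -> (forall x, `|g x| <= 1) ->
  (forall r, s <= r <= t -> `|\int[mu]_x (stress_rate i j r x * g x) - beta| <= e) ->
  `|\int[mu]_x (sigma t x i j * g x) - \int[mu]_x (sigma s x i j * g x)
    + E * beta * (t - s)| <= E * e * (t - s).
Proof.
move=> s0 st tT mg g1 gb.
apply: (@increment_against_bounded _ T E (fun t x => sigma t x i j)
  (stress_rate i j)) => //.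
- exact/L2_continuous_L1/(C_L2_continuous (v := fun t x => sigma t x i j)).
- exact: stress_rate_continuous.
move=> chi a b p q schi a0 bT chi0 sp sq pp pq.
have tpq := torus_test_tensor sp sq pp pq.
have := sigma_eq (spacetime_test_tensor tpq schi a0 bT chi0) i j.
move=> I0; rewrite -[RHS]I0; apply: eq_Rintegral => r _.
apply: eq_Rintegral => x _.
have [_ ->] := is_derive_time (tensor p q) (x, r) schi.
by rewrite /stress_rate /spacetime_tensor /=; ring.
Qed.

Lemma stress_dissipation M t x : 2 * P <= M -> M < eucl_norm (sigma t x) ->
  0 <= \sum_i \sum_j sigma t x i j * stress_rate i j t x.
Proof.
move=> PM Ms; apply: relaxation_dissipative => //.
  rewrite /Deps -{1}(ger0_norm (eucl_norm_ge0 (symgrad (u t) x))) -sqrtr_sqr.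
  by rewrite ler_wsqrtr// lerDl sqr_ge0.
exact: le_trans PM (ltW Ms).
Qed.

(** The total excess over [M] vanishes initially, and does not increase. *)
Lemma stress_bound M t : 2 * P <= M -> 0 <= t <= T ->
  {ae mu, forall x, eucl_norm (sigma 0 x) <= M} ->
  {ae mu, forall x, eucl_norm (sigma t x) <= M}.
Proof.
move=> PM tT s0M.
have M0 : 0 <= M by rewrite (le_trans _ PM)// mulr_ge0// ltW.
have sc i j : L1_continuous mu T (fun t x => sigma t x i j).
  exact/L2_continuous_L1/(C_L2_continuous (v := fun t x => sigma t x i j)).
have T0 : (0 : R) <= 0 <= T.
  by case/andP: tT => t0 tT; apply/andP; split=> //; exact: le_trans tT.
have iex := integrable1_excess M0 sc.
have dec := total_excess_nonincreasing E_gt0 M0 sc stress_rate_continuous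
  stress_increment (fun t x _ => @stress_dissipation M t x PM) tT.
have ex0 : \int[mu]_x excess M (sigma 0 x) = 0.
  transitivity (\int[mu]_x (cst 0 : X -> R) x).
    apply: Rintegral_ae_eq.
    - exact: integrable1_measurable (iex 0 T0).
    - exact: measurable_cst.
    - by apply: (ae_sub s0M) => x sx; rewrite /excess max_r// subr_le0.
  by rewrite Rintegral_cst// mul0r.
have ext : {ae mu, forall x, excess M (sigma t x) = 0}.
  apply: ae_eq0_of_Rintegral_norm; first exact: iex.
  by under eq_Rintegral do rewrite ger0_norm ?excess_ge0//; rewrite -ex0.
apply: (ae_sub ext) => x ex.
by rewrite -subr_le0 -ex /excess le_max lexx.
Qed.

Lemma stress_bounded_entry M t i j : 2 * P <= M -> 0 <= t <= T ->
  {ae mu, forall x, eucl_norm (sigma 0 x) <= M} ->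
  {ae mu, forall x, `|sigma t x i j| <= M}.
Proof.
move=> PM tT s0M; apply: (ae_sub (stress_bound PM tT s0M)) => x.
exact/le_trans/normr_entry_le.
Qed.

End stress.

(** * The pointwise bound *)

Section duality.
Variable R : realType.
Local Notation X := (measurableTypeR R * measurableTypeR R)%type.
Local Notation mu := (@torus_measure R).

(** Truncating the test function reduces weak-* measurability to the continuity
    of the pairings with bounded functions. *)
Lemma measurable_pairing (T M : R) (w : R -> X -> R) (g : X -> R) :
  L1_continuous mu T w ->
  (forall t, 0 <= t <= T -> {ae mu, forall x, `|w t x| <= M}) ->
  integrable1 mu g ->
  measurable_fun (`]0, T[%classic : set (measurableTypeR R))
    (fun t => \int[mu]_x (w t x * g x)).
Proof.
move=> wc wM g1; have mg := integrable1_measurable g1.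
pose G n x := Num.max (- n%:R) (Num.min n%:R (g x)) : R.
have mG n : measurable_fun setT (G n : X -> R).
  by apply: measurable_maxr => //; exact: measurable_minr.
have Gn n x : `|G n x| <= n%:R.
  rewrite ler_norml /G le_max lexx /= ge_max ge_min lexx /= andbT.
  by rewrite (@le_trans _ _ 0) ?oppr_le0.
have Gg n x : `|G n x| <= `|g x|.
  have n0 : 0 <= n%:R :> R by [].
  have y0 := normr_ge0 (g x); have y1 := ler_norm (g x).
  have y2 := ler_norm (- g x); rewrite normrN in y2.
  rewrite ler_norml /G le_max le_min ge_max ge_min; apply/andP; split.
    apply/orP; right; apply/andP; split; last by rewrite lerNl.
    by rewrite (le_trans _ n0)// oppr_le0.
  by rewrite y1 orbT andbT (le_trans _ y0)// oppr_le0.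
apply: (measurable_fun_cvg (h := fun n t => \int[mu]_x (w t x * G n x))).
  move=> n; have := within_integrable (L1_continuous_within wc (mG n) (Gn n)).
  by move=> /measurable_int/measurable_EFinP.
move=> t /itv_cc_oo tT.
have mw := integrable1_measurable (wc.1 _ tT).
apply: (@Rintegral_dominated_cvg _ _ R mu setT (fun n x => w t x * G n x)
  (fun x => w t x * g x) (fun x => M * `|g x|)) => //.
- by move=> n; exact: measurable_funM.
- exact: measurable_funM.
- apply: aeW => x _; apply: cvg_near_cst; near=> n.
  have gn : `|g x| <= n%:R by near: n; exact: nbhs_infty_ger.
  move: gn; rewrite ler_norml => /andP[ng gn].
  by rewrite /G min_r// max_r.
- by apply: integrable1Z; exact: integrable1_norm.
- apply: (ae_sub (wM t tT)) => x wx n _.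
  by rewrite normrM ler_pM.
Unshelve. all: by end_near. Qed.

End duality.

Theorem lemma2p3 (R : realType) (T P E eps : R)
    (T_gt0 : 0 < T) (P_gt0 : 0 < P) (E_gt0 : 0 < E) (eps_gt0 : 0 < eps)
    (u : R -> R * R -> 'rV[R]_2) (sigma : R -> R * R -> 'M[R]_2)
    (u_CH1 : forall i, C_H1 T (fun t x => u t x 0 i))
    (sigma_sym : forall (t : R) x, 0 <= t <= T -> (sigma t x)^T = sigma t x)
    (sigma_CH1w : forall i j, C_H1w T (fun t x => sigma t x i j))
    (sigma_CL2 : forall i j, C_L2 T (fun t x => sigma t x i j))
    (sigma0_Linfty : forall i j, torus_L +oo%E (fun x => sigma 0 x i j))
    (sigma0_H1 : forall i j, H1 (fun x => sigma 0 x i j))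
    (sigma_eq : stress_equation T P E eps u sigma) :
  Linfty_Linfty T sigma /\
  forall t : R, 0 <= t <= T ->
    (Linfty_norm (sigma t) <= Linfty_norm (sigma 0%R) + (2 * P)%:E)%E.
Proof.
have N0 : (0 <= Linfty_norm (sigma 0%R))%E by exact: Lnorm_ge0.
have fin0 : Linfty_norm (sigma 0) \is a fin_num.
  rewrite ge0_fin_numE//.
  have [C00 H00] := torus_Linfty_bounded (sigma0_Linfty 0 0).
  have [C01 H01] := torus_Linfty_bounded (sigma0_Linfty 0 1).
  have [C10 H10] := torus_Linfty_bounded (sigma0_Linfty 1 0).
  have [C11 H11] := torus_Linfty_bounded (sigma0_Linfty 1 1).
  apply: (@le_lt_trans _ _ (C00 + C01 + (C10 + C11))%:E); last exact: ltry.
  apply: Linfty_norm_le.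
  have H0 := ae_sub2 H00 H01 (fun x => @conj _ _).
  have H1 := ae_sub2 H10 H11 (fun x => @conj _ _).
  apply: (ae_sub2 H0 H1) => x [? ?] [? ?].
  by apply: (le_trans (eucl_norm_le_sum _)); rewrite !sum_I2 !lerD.
pose S := fine (Linfty_norm (sigma 0)); pose M := S + 2 * P.
have S0 : 0 <= S by exact: fine_ge0.
have PM : 2 * P <= M by rewrite lerDr.
have s0M : {ae (@torus_measure R), forall x, eucl_norm (sigma 0 x) <= M}.
  apply: (ae_sub (Linfty_norm_ge (sigma 0))) => x.
  rewrite -(fineK fin0) lee_fin => /le_trans; apply.
  by rewrite /M lerDl mulr_ge0// ltW.
have bound t (tT : 0 <= t <= T) :=
  stress_bound P_gt0 E_gt0 u_CH1 sigma_CL2 sigma_eq PM tT s0M.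
have entry t i j (tT : 0 <= t <= T) :=
  stress_bounded_entry P_gt0 E_gt0 u_CH1 sigma_CL2 sigma_eq i j PM tT s0M.
have sc i j := L2_continuous_L1 (C_L2_continuous (sigma_CL2 i j)).
have itvW (t : R) : 0 < t < T -> 0 <= t <= T.
  by move=> /andP[/ltW -> /ltW ->].
split; last first.
  move=> t tT; apply: (le_trans (Linfty_norm_le (bound t tT))).
  by rewrite /M EFinD /S fineK.
split.
- move=> i j g gL1; have g1 := torus_L1_integrable gL1.
  exact (measurable_pairing (sc i j) (fun t tT => entry t i j tT) g1).
- apply: aeW => t t0T i j; have tT := itvW t t0T.
  have [pf _] := (sigma_CL2 i j).1 t tT.
  apply: (bounded_torus_Linfty pf _ (entry t i j tT)).
  exact: torus_L_measurable ((sigma_CL2 i j).1 t tT).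
- exists M; apply: aeW => t t0T.
  exact: Linfty_norm_le (bound t (itvW t t0T)).
Qed.
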